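(* Let $n\ge1$ and suppose $\alpha_{\boldsymbol N}(a,b)$ and $\beta_{\boldsymbol N}(a,b)$ form a WP Bailey pair with respect to $\mathbf B^{(1)}$. For complex parameters $\rho_1,\rho_2$ let \begin{align*} \alpha'_{\boldsymbol N}(a,b)&:=\frac{\prod_{r=1}^n(\rho_1x_r,\,\rho_2x_r;q,p)_{N_r}}{(aq/\rho_1,\,aq/\rho_2;q,p)_{|\boldsymbol N|}}\left(\frac{aq}{\rho_1\rho_2}\right)^{|\boldsymbol N|}\prod_{r=1}^nx_r^{-N_r}\cdot q^{\sum_{r<s}N_rN_s}\,\alpha_{\boldsymbol N}\big(a,b\rho_1\rho_2/(aq)\big),\\ \beta'_{\boldsymbol N}(a,b)&:=\frac{(b\rho_1/a,\,b\rho_2/a;q,p)_{|\boldsymbol N|}}{(aq/\rho_1,\,aq/\rho_2;q,p)_{|\boldsymbol N|}}\sum_{\substack{0\le k_r\le N_r\\ r=1,\dots,n}}\Bigg(\frac{\prod_{r=1}^n(\rho_1x_r,\,\rho_2x_r;q,p)_{k_r}}{(b\rho_1/a,\,b\rho_2/a;q,p)_{|\boldsymbol k|}}\frac{(b;q,p)_{|\boldsymbol N|+|\boldsymbol k|}}{\prod_{r,s=1}^n(q^{1+k_r-k_s}x_r/x_s;q,p)_{N_r-k_r}}\\ &\quad\times\prod_{r=1}^n\frac{\theta(b\rho_1\rho_2x_rq^{k_r+|\boldsymbol k|}/(aq);p)}{\theta(b\rho_1\rho_2x_r/(aq);p)}\prod_{r=1}^n\frac{(aq^{1+|\boldsymbol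 N|-N_r}/(\rho_1\rho_2x_r);q,p)_{N_r-k_r}}{(b\rho_1\rho_2x_r/a;q,p)_{|\boldsymbol k|+N_r}}\\ &\quad\times\left(\frac{aq}{\rho_1\rho_2}\right)^{|\boldsymbol k|}\prod_{r=1}^nx_r^{-k_r}\cdot q^{\sum_{r<s}k_rk_s}\,\beta_{\boldsymbol k}\big(a,b\rho_1\rho_2/(aq)\big)\Bigg). \end{align*} Then $\alpha'_{\boldsymbol N}(a,b)$ and $\beta'_{\boldsymbol N}(a,b)$ form a WP Bailey pair with respect to $\mathbf B^{(2)}$.
   Context: Let $q,p$ be complex numbers with $q\neq 0$ and $|p|<1$. For $a\ne 0$ put $\theta(a;p)=\prod_{j\ge 0}(1-ap^j)(1-p^{j+1}/a)$. For an integer $k$ the $q,p$-shifted factorial is $(a;q,p)_k=\prod_{j=0}^{k-1}\theta(aq^j;p)$ if $k\ge 0$ (empty product $=1$), and $(a;q,p)_{k}=\big(\prod_{j=k}^{-1}\theta(aq^{j};p)\big)^{-1}$ if $k<0$. Write $(a_1,\dots,a_m;q,p)_k=(a_1;q,p)_k\cdots(a_m;q,p)_k$. For a tuple $\boldsymbol k=(k_1,\dots,k_n)$, $|\boldsymbol k|=k_1+\cdots+k_n$; $\sum_{r<s}$ is over $1\le r<s\le n$. The $x_1,\dots,x_n$ are fixed complex parameters. All parameters are nonzero and generic in the sense that no denominators vanish. WP Bailey pair: given a matrix $\mathbf B=(B_{\boldsymbol k\boldsymbol j}(a,b))$ indexed by $n$-tuples of nonnegative integers, two sequences $\alpha_{\boldsymbol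 N}(a,b)$ and $\beta_{\boldsymbol N}(a,b)$ (indexed by $n$-tuples of nonnegative integers and depending on parameters $a,b$) form a WP Bailey pair with respect to $\mathbf B$ if for all $\boldsymbol N$ and all (generic) $a,b$ $$\beta_{\boldsymbol N}(a,b)=\sum_{0\le j_r\le N_r,\ r=1,\dots,n}B_{\boldsymbol N\boldsymbol j}(a,b)\,\alpha_{\boldsymbol j}(a,b).$$ The matrices $\mathbf B^{(1)}$ and $\mathbf B^{(2)}$ have entries $$B^{(1)}_{\boldsymbol k\boldsymbol j}(a,b)=\frac{(b/a;q,p)_{|\boldsymbol k|-|\boldsymbol j|}}{\prod_{r,s=1}^n(q^{1+j_r-j_s}x_r/x_s;q,p)_{k_r-j_r}}\prod_{r=1}^n\frac{(bx_r;q,p)_{j_r+|\boldsymbol k|}}{(ax_rq;q,p)_{k_r+|\boldsymbol j|}},$$ $$B^{(2)}_{\boldsymbol k\boldsymbol j}(a,b)=\frac{(b;q,p)_{|\boldsymbol k|+|\boldsymbol j|}\prod_{r=1}^n(bq^{|\boldsymbol k|-k_r}/(ax_r);q,p)_{k_r-j_r}}{\prod_{r,s=1}^n(q^{1+j_r-j_s}x_r/x_s;q,p)_{k_r-j_r}\prod_{r=1}^n(ax_rq;q,p)_{k_r+|\boldsymbol j|}}.$$ *)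

(* Defs.v *)
From HB Require Import structures.
From mathcomp Require Export all_boot all_order all_algebra.
From mathcomp Require Export all_classical all_reals all_analysis.
From mathcomp Require Export complex.

Set Implicit Arguments.
Unset Strict Implicit.
Unset Printing Implicit Defensive.

Import Order.TTheory GRing.Theory Num.Theory.
Import numFieldNormedType.Exports.

Local Open Scope classical_set_scope.
Local Open Scope ring_scope.

Notation mindex n := {ffun 'I_n -> nat}.

Definition mabs (n : nat) (k : mindex n) : nat := (\sum_(r < n) k r)%N.

Definition mcross (n : nat) (k : mindex n) : nat :=
  (\sum_(r < n) \sum_(s < n | r < s) k r * k s)%N.

Definition mbox (n : nat) (N : mindex n) : set (mindex n) :=
  [set j | forall r, (j r <= N r)%N].

(* The definitions are stated over a numFieldType K so that the topology of K
   is inferred; the theorem takes K to be the complex field R[i]. *)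
Section EllipticBailey.
Variable K : numFieldType.
Implicit Types (q p a b z rho : K).

(* The product converges in the complex field for |p| < 1 and z != 0, so the
   total operator limn returns its value there. *)
Definition theta z p : K :=
  limn (fun m : nat => \prod_(0 <= j < m) ((1 - z * p ^+ j) * (1 - p ^+ j.+1 / z))).

(* Negz m is the integer -(m+1), and prod_{j=-(m+1)}^{-1} is reindexed by
   j = -(i+1) with 0 <= i <= m. *)
Definition qpfact q p z (k : int) : K :=
  match k with
  | Posz m => \prod_(0 <= j < m) theta (z * q ^+ j) p
  | Negz m => (\prod_(0 <= i < m.+1) theta (z * q ^- i.+1) p)^-1
  end.

Variable n : nat.
Implicit Types (x : 'I_n -> K) (k j N : mindex n).

(* G is the set of generic (a, b), on which the sequences are defined. *)
Definition WP_Bailey_pair (G : K -> K -> Prop)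
    (B : mindex n -> mindex n -> K -> K -> K)
    (alpha beta : mindex n -> K -> K -> K) : Prop :=
  forall a b, G a b -> forall N,
    beta N a b = \sum_(j \in mbox N) B N j a b * alpha j a b.

(* prod_{r,s} (q^{1+j_r-j_s} x_r/x_s; q,p)_{k_r-j_r} *)
Definition denA q p x k j : K :=
  \prod_(r < n) \prod_(s < n)
    qpfact q p (q ^ (1 + (j r)%:Z - (j s)%:Z) * x r / x s)
               ((k r)%:Z - (j r)%:Z).

(* prod_r (a x_r q; q,p)_{k_r+|j|} *)
Definition denB q p x a k j : K :=
  \prod_(r < n) qpfact q p (a * x r * q) (k r + mabs j)%N.

Definition B1 q p x k j a b : K :=
  qpfact q p (b / a) ((mabs k)%:Z - (mabs j)%:Z) / denA q p x k j
  * ((\prod_(r < n) qpfact q p (b * x r) (j r + mabs k)%N) / denB q p x a k j).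

Definition B2 q p x k j a b : K :=
  (qpfact q p b (mabs k + mabs j)%N
   * \prod_(r < n) qpfact q p
       (b * q ^ ((mabs k)%:Z - (k r)%:Z) / (a * x r)) ((k r)%:Z - (j r)%:Z))
  / (denA q p x k j * denB q p x a k j).

(* a, b are nonzero and no denominator of B1, equivalently of B2, vanishes. *)
Definition B_generic q p x a b : Prop :=
  [/\ a != 0, b != 0 &
      forall k j, mbox k j -> denA q p x k j != 0 /\ denB q p x a k j != 0].

(* (a q/(rho1 rho2))^{|k|} prod_r x_r^{-k_r} q^{sum_{r<s} k_r k_s} *)
Definition weight q x rho1 rho2 a k : K :=
  (a * q / (rho1 * rho2)) ^+ mabs k * (\prod_(r < n) x r ^- k r)
  * q ^+ mcross k.

Definition shiftb q rho1 rho2 a b : K := b * rho1 * rho2 / (a * q).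

(* (a q/rho1, a q/rho2; q,p)_m *)
Definition den_rho q p rho1 rho2 a (m : nat) : K :=
  qpfact q p (a * q / rho1) m * qpfact q p (a * q / rho2) m.

(* (b rho1/a, b rho2/a; q,p)_m *)
Definition num_rho q p rho1 rho2 a b (m : nat) : K :=
  qpfact q p (b * rho1 / a) m * qpfact q p (b * rho2 / a) m.

(* prod_r (rho1 x_r, rho2 x_r; q,p)_{k_r} *)
Definition num_x q p x rho1 rho2 k : K :=
  \prod_(r < n) (qpfact q p (rho1 * x r) (k r) * qpfact q p (rho2 * x r) (k r)).

Definition alpha' q p x rho1 rho2 (alpha : mindex n -> K -> K -> K) N a b : K :=
  num_x q p x rho1 rho2 N / den_rho q p rho1 rho2 a (mabs N)
  * weight q x rho1 rho2 a N * alpha N a (shiftb q rho1 rho2 a b).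

Definition beta' q p x rho1 rho2 (beta : mindex n -> K -> K -> K) N a b : K :=
  num_rho q p rho1 rho2 a b (mabs N) / den_rho q p rho1 rho2 a (mabs N)
  * \sum_(k \in mbox N)
     (num_x q p x rho1 rho2 k / num_rho q p rho1 rho2 a b (mabs k)
      * (qpfact q p b (mabs N + mabs k)%N / denA q p x N k)
      * (\prod_(r < n)
           (theta (b * rho1 * rho2 * x r * q ^+ (k r + mabs k) / (a * q)) p
            / theta (b * rho1 * rho2 * x r / (a * q)) p))
      * (\prod_(r < n)
           (qpfact q p
              (a * q ^ (1 + (mabs N)%:Z - (N r)%:Z) / (rho1 * rho2 * x r))
              ((N r)%:Z - (k r)%:Z)
            / qpfact q p (b * rho1 * rho2 * x r / a) (mabs k + N r)%N))
      * weight q x rho1 rho2 a k * beta k a (shiftb q rho1 rho2 a b)).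

(* No denominator in alpha', beta' (beyond those of B_generic) vanishes. *)
Definition rho_generic q p x rho1 rho2 a b : Prop :=
  [/\ forall m : nat, den_rho q p rho1 rho2 a m != 0,
      forall m : nat, num_rho q p rho1 rho2 a b m != 0,
      forall r, theta (b * rho1 * rho2 * x r / (a * q)) p != 0 &
      forall N k, mbox N k -> forall r,
        qpfact q p (b * rho1 * rho2 * x r / a) (mabs k + N r)%N != 0].

End EllipticBailey.

(* Main.v *)
Require Import Defs.
From mathcomp Require Import perm ring lra zify.
Import Order.TTheory GRing.Theory Num.Theory.
Import numFieldNormedType.Exports.

(** Inserting the expansion of beta in terms of alpha at (a, c), where
    c = b rho1 rho2 / (a q), into the definition of beta' and exchanging the two
    finite sums reduces the theorem to one identity for each coefficient of
    alpha_j: a sum over j <= k <= N equals a product. This is an A_n elliptic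
    Jackson summation, [elliptic_jackson]; the shift c of b is what balances it.

    The summation is proved by induction on |N| - |j|. Each term of the sum
    satisfies a linear recursion whose coefficients are free of k: it raises one
    coordinate of j, or lowers a chosen coordinate of N while (a, b) becomes
    (a q, b q) ([jackson_term_rec]). The product side satisfies the same
    recursion ([jackson_value_rec]). After division by common factors, both
    recursions are instances of one elliptic partial fraction expansion,
    [lagrange]: Lagrange interpolation for products of theta functions. It
    follows, by induction on the number of nodes, from the three-term relation
    between products of four theta functions.

    The three-term relation is derived from the definition of theta as an
    infinite product. The Jacobi triple product ([jacobi_triple_product], the
    limit of the q-binomial theorem) turns theta into a bilateral series. The
    product of the series at x y and x / y, summed along diamonds instead of
    squares, separates into a 2 x 2 determinant of functions of x and of y
    ([theta_rank_two]). Hence theta (x y) theta (x / y) is essentially a minor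
    of a matrix with two rows, and the three-term relation is the Pluecker
    relation between such minors ([theta_three_term]). *)

Local Open Scope classical_set_scope.
Local Open Scope ring_scope.
Set Implicit Arguments.
Unset Strict Implicit.
Unset Printing Implicit Defensive.

(** * Absolute convergence over the complex field *)

(** All that the analysis below uses of the complex numbers: a norm with values
    in the reals, two coordinates that it controls, and square roots. Working
    over an abstract K keeps its topology the one of a numFieldType, in which
    theta is defined. *)
Record complex_over (R : realType) (K : numFieldType) := ComplexOver {
  emb : {rmorphism R -> K};
  nm : K -> R;
  re : K -> R;
  im : K -> R;
  nmE : forall z, `|z| = emb (nm z);
  emb_le : forall s t, (emb s <= emb t) = (s <= t);
  emb_gt0 : forall e, 0 < e -> exists s, e = emb s;
  reB : forall y z, re (y - z) = re y - re z;
  imB : forall y z, im (y - z) = im y - im z;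
  re_le_nm : forall z, `|re z| <= nm z;
  im_le_nm : forall z, `|im z| <= nm z;
  re_im_split : forall s t, exists l,
    forall z, nm (z - l) <= `|re z - s| + `|im z - t|;
  has_sqrt : forall z : K, exists s, s ^+ 2 = z
}.

Lemma complex_over_complex (R : realType) : complex_over R R[i].
Proof.
have nmE (z : R[i]) : `|z| = (real_complex R) (complex.Re `|z|).
  by rewrite normc_def.
have re_le (z : R[i]) : `|complex.Re z| <= complex.Re `|z|.
  by rewrite -lecR -nmE normc_ge_Re.
apply: (@ComplexOver R R[i] (real_complex R) (fun z => complex.Re `|z|)
  (@complex.Re R) (@complex.Im R)).
- exact: nmE.
- exact: lecR.
- by move=> [a b]; rewrite ltcE /= => /andP[/eqP -> _]; exists a.
- by move=> [? ?] [? ?].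
- by move=> [? ?] [? ?].
- exact: re_le.
- move=> z; have := re_le (z * 'i%C); rewrite ReiNIm normrN.
  by rewrite normrM complexiE normCi mulr1.
- move=> s t; exists (s +i* t)%C => -[a b] /=.
  rewrite -[leRHS]ger0_norm ?addr_ge0 // -sqrtr_sqr; apply: ler_wsqrtr.
  rewrite -(real_normK (num_real (a - s))) -(real_normK (num_real (b - t))).
  by rewrite sqrrD lerD2r lerDl mulrn_wge0 // mulr_ge0.
- by move=> z; exists (sqrtc z); rewrite sqr_sqrtc.
Qed.

Section Sequences.
Variables (R : realType) (K : numFieldType) (X : complex_over R K).
Local Notation nm := (nm X).
Local Notation emb := (emb X).
Implicit Types (u v : nat -> K) (w : nat -> R) (y z : K).

Lemma emb_inj : injective emb.
Proof. exact: fmorph_inj. Qed.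

Lemma nm_ge0 z : 0 <= nm z.
Proof. by rewrite -(emb_le X) rmorph0 -(nmE X) normr_ge0. Qed.

Lemma nmM y z : nm (y * z) = nm y * nm z.
Proof. by apply: emb_inj; rewrite rmorphM /= -!(nmE X) normrM. Qed.

Lemma nmD y z : nm (y + z) <= nm y + nm z.
Proof. by rewrite -(emb_le X) rmorphD /= -!(nmE X) ler_normD. Qed.

Lemma nm1 : nm 1 = 1.
Proof. by apply: emb_inj; rewrite -(nmE X) normr1 rmorph1. Qed.

Lemma nmX z n : nm (z ^+ n) = nm z ^+ n.
Proof. by elim: n => [|n IH]; rewrite ?expr0 ?nm1 // !exprS nmM IH. Qed.

Lemma nmV z : nm (z^-1) = (nm z)^-1.
Proof. by apply: emb_inj; rewrite fmorphV -!(nmE X) normfV. Qed.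

Lemma nm_eq0 z : (nm z == 0) = (z == 0).
Proof. by rewrite -[z == 0]normr_eq0 (nmE X) fmorph_eq0. Qed.

Lemma nm0 : nm 0 = 0.
Proof. by apply/eqP; rewrite nm_eq0. Qed.

Lemma nm_gt0 z : (0 < nm z) = (z != 0).
Proof. by rewrite lt_def nm_ge0 andbT nm_eq0. Qed.

Lemma nmN z : nm (- z) = nm z.
Proof. by apply: emb_inj; rewrite -!(nmE X) normrN. Qed.

Lemma nm_sum (I : Type) (s : seq I) (P : pred I) (F : I -> K) :
  nm (\sum_(i <- s | P i) F i) <= \sum_(i <- s | P i) nm (F i).
Proof.
elim/big_ind2: _ => //; last by move=> x1 x2 y1 y2 h1 h2; apply: (le_trans (nmD _ _)); exact: lerD.
by rewrite nm0.
Qed.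

Lemma nm_prod (I : Type) (s : seq I) (P : pred I) (F : I -> K) :
  nm (\prod_(i <- s | P i) F i) = \prod_(i <- s | P i) nm (F i).
Proof. by apply: (big_morph nm nmM nm1). Qed.

Lemma cvg_nm v l w : (forall n, nm (v n - l) <= w n) -> w @ \oo --> (0 : R) ->
  v @ \oo --> l.
Proof.
move=> vw /cvgrPdist_lt w0; apply/cvgrPdist_lt => e e0.
have [s es] := emb_gt0 X e0.
have s0 : 0 < s.
  by rewrite lt_def -(fmorph_eq0 emb) -(emb_le X) -es rmorph0 -lt_def.
near=> n; rewrite distrC es (nmE X) lt_def (inj_eq emb_inj) emb_le -lt_def.
apply: (le_lt_trans (vw n)); apply: (le_lt_trans (ler_norm _)).
by rewrite -normrN -[- w n]add0r; near: n; apply: w0.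
Unshelve. all: by end_near. Qed.

(** Completeness is borrowed from R through the coordinates: each of them has
    absolutely summable increments, hence telescopes to a convergent series. *)
Lemma cvg_of_abs_increments v w : (forall n, nm (v n.+1 - v n) <= w n) ->
  cvgn (series w) -> cvgn v.
Proof.
move=> vw cw.
have key (f : K -> R) : (forall y z, f (y - z) = f y - f z) ->
    (forall z, `|f z| <= nm z) -> cvgn (f \o v).
  move=> fB fn.
  have h : cvgn (series (fun n => f (v n.+1) - f (v n))).
    apply: normed_cvg; apply: series_le_cvg cw => n //=.
      by apply: le_trans (vw n); exact: nm_ge0.
    by rewrite -fB; apply: le_trans (vw n); exact: fn.
  have -> : f \o v = (fun n => series (fun n => f (v n.+1) - f (v n)) n + f (v 0%N)).
    by apply/funext => n; rewrite /series /= telescope_sumr // subrK.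
  by apply: is_cvgD => //; exact: is_cvg_cst.
have /cvg_ex[/= s hs] : cvgn (re X \o v) by apply: key (reB X) (re_le_nm X).
have /cvg_ex[/= t ht] : cvgn (im X \o v) by apply: key (imB X) (im_le_nm X).
have [l hl] := re_im_split X s t.
apply/cvg_ex; exists l; apply: cvg_nm (fun n => hl (v n)) _.
rewrite -[0]addr0; apply: cvgD; apply/norm_cvg0P; exact/subr_cvg0.
Qed.

End Sequences.

(** * Infinite products *)

Section Products.
Variables (R : realType) (K : numFieldType) (X : complex_over R K).
Local Notation nm := (nm X).
Local Notation emb := (emb X).
Implicit Types (u v : nat -> K) (w : nat -> R) (y z : K).

Definition abs_summable u := cvgn (series (fun n => nm (u n))).

Lemma abs_summable_le u w : (forall n, nm (u n) <= w n) -> cvgn (series w) ->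
  abs_summable u.
Proof.
move=> uw; apply: series_le_cvg => // n; first exact: nm_ge0.
by apply: le_trans (uw n); exact: nm_ge0.
Qed.

Lemma partial_prod_bounded u : abs_summable u ->
  exists2 B, 0 < B & forall n, nm (\prod_(0 <= j < n) (1 + u j)) <= B.
Proof.
move=> su; exists (expR (limn (series (fun n => nm (u n))))) => [|n].
  exact: expR_gt0.
apply: (@le_trans _ _ (expR (series (fun n => nm (u n)) n))); last first.
  rewrite ler_expR; apply: nondecreasing_cvgn_le => //.
  by apply: nondecreasing_series => ? _ _; exact: nm_ge0.
rewrite nm_prod /series /= expR_sum; apply: ler_prod => i _.
rewrite nm_ge0 /=; apply: le_trans (expR_ge1Dx _).
by apply: le_trans (nmD _ _ _) _; rewrite nm1.
Qed.

(** The partial products stay bounded, by expR of the sum of the norms, so that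
    their increments are dominated by a multiple of nm (u n). *)
Lemma cvg_prod u : abs_summable u ->
  cvgn (fun n => \prod_(0 <= j < n) (1 + u j)).
Proof.
move=> su; have [B B0 hB] := partial_prod_bounded su.
apply: (@cvg_of_abs_increments _ _ X _ (fun n => B * nm (u n))) => [n|].
  rewrite big_nat_recr //= mulrDr mulr1 addrAC subrr add0r nmM.
  by rewrite ler_wpM2r ?nm_ge0.
exact: is_cvg_seriesZ.
Qed.

(** The inverse factors are again of the form 1 + u' n with u' absolutely
    summable. Hence the inverse products converge as well, and the two limits
    have product 1. *)
Lemma lim_prod_neq0 u : abs_summable u -> (forall n, 1 + u n != 0) ->
  limn (fun n => \prod_(0 <= j < n) (1 + u j)) != 0.
Proof.
move=> su nz; pose u' n := - u n / (1 + u n).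
have u'E n : 1 + u' n = (1 + u n)^-1.
  by rewrite /u'; field; exact: nz.
have u0 : (fun n => nm (u n)) @ \oo --> (0 : R) by exact: cvg_series_cvg_0.
have su' : abs_summable u'.
  have c1 : (fun n => (nm (1 + u n))^-1) @ \oo --> (1^-1 : R).
    apply: cvgV; first exact: oner_neq0.
    apply/subr_cvg0/norm_cvg0P.
    apply: (@squeeze_cvgr _ _ _ _ (fun=> 0) (fun n => nm (u n))) => //; last exact: cvg_cst.
    near=> n; rewrite normr_ge0 /= ler_norml lerBlDr lerBrDr.
    have := nmD X 1 (u n); have := nmD X (1 + u n) (- u n).
    by rewrite addrK nm1 nmN; lra.
  have [M [_ hM]] : bounded_fun (fun n => (nm (1 + u n))^-1).
    by apply: cvg_seq_bounded; apply/cvg_ex; exists 1^-1.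
  apply: (@abs_summable_le _ (fun n => (M + 1) * nm (u n))) => [n|]; last exact: is_cvg_seriesZ.
  rewrite /u' nmM nmV nmN mulrC ler_wpM2r ?nm_ge0 //.
  have := hM (M + 1); rewrite ltrDl ltr01 => /(_ isT n I) /=.
  by apply: le_trans; exact: ler_norm.
have cu := cvg_prod su; have cu' := cvg_prod su'.
have : (fun n => (\prod_(0 <= j < n) (1 + u j)) * (\prod_(0 <= j < n) (1 + u' j))) @ \oo
   --> limn (fun n => \prod_(0 <= j < n) (1 + u j)) * limn (fun n => \prod_(0 <= j < n) (1 + u' j)).
  exact: cvgM.
have -> : (fun n => (\prod_(0 <= j < n) (1 + u j)) * (\prod_(0 <= j < n) (1 + u' j))) = fun=> 1.
  apply/funext => n; rewrite -big_split /= big1 // => i _.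
  by rewrite u'E mulfV.
move=> /cvg_lim; rewrite lim_cst // => h.
by apply/eqP => l0; move: (h (@norm_hausdorff _ _)); rewrite l0 mul0r => /eqP; rewrite oner_eq0.
Unshelve. all: by end_near. Qed.

End Products.

(** * The theta product *)

Lemma limn_unique (K : numFieldType) (f : nat -> K) (s t : K) :
  f @ \oo --> s -> f @ \oo --> t -> s = t.
Proof. by move=> fs ft; rewrite -(cvg_lim (@norm_hausdorff _ _) fs) (cvg_lim (@norm_hausdorff _ _) ft). Qed.

Section ThetaProduct.
Variables (R : realType) (K : numFieldType) (X : complex_over R K).
Variable p : K.
Hypothesis p_lt1 : `|p| < 1.
Local Notation nm := (nm X).
Local Notation emb := (emb X).
Implicit Types (z w : K).

Lemma nmp_lt1 : nm p < 1.
Proof.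
move: p_lt1; rewrite (nmE X) !lt_def -(emb_le X) rmorph1 => /andP[h ->].
by rewrite andbT; apply: contra_neq h => <-; rewrite rmorph1.
Qed.

Lemma geometric_summable (B : R) : cvgn (series (fun n => B * nm p ^+ n)).
Proof.
apply: is_cvg_geometric_series.
by rewrite ger0_norm ?nm_ge0 ?nmp_lt1.
Qed.

Definition theta_partial z (m : nat) : K :=
  \prod_(0 <= j < m) ((1 - z * p ^+ j) * (1 - p ^+ j.+1 / z)).

Definition theta_dev z (j : nat) : K :=
  - (z * p ^+ j) - p ^+ j.+1 / z + (z * p ^+ j) * (p ^+ j.+1 / z).

Lemma theta_partialE z m :
  theta_partial z m = \prod_(0 <= j < m) (1 + theta_dev z j).
Proof. by apply: eq_bigr => j _; rewrite /theta_dev; ring. Qed.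

Lemma nmpX_le1 j : nm p ^+ j <= 1.
Proof. by apply: exprn_ile1; rewrite ?nm_ge0 // ltW ?nmp_lt1. Qed.

Lemma theta_dev_summable z : abs_summable X (theta_dev z).
Proof.
pose B := nm z + nm p / nm z + nm z * (nm p / nm z).
apply: (@abs_summable_le _ _ _ _ (fun n => B * nm p ^+ n)); last exact: geometric_summable.
move=> n; apply: (le_trans (nmD _ _ _)); rewrite /B mulrDl lerD //.
  apply: (le_trans (nmD _ _ _)); rewrite !nmN mulrDl !nmM nmV !nmX exprS.
  by rewrite lerD // mulrAC.
rewrite !nmM nmV !nmX exprS -!mulrA ler_wpM2l ?nm_ge0 // mulrCA ler_wpM2l ?nm_ge0 //.
rewrite [leRHS]mulrC ler_wpM2l ?exprn_ge0 ?nm_ge0 //.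
by rewrite ler_piMl ?invr_ge0 ?nm_ge0 ?nmpX_le1.
Qed.

Lemma cvg_theta z : theta_partial z @ \oo --> theta z p.
Proof.
have -> : theta z p = limn (theta_partial z) by [].
suff : cvgn (theta_partial z) by [].
have -> : theta_partial z = fun m => \prod_(0 <= j < m) (1 + theta_dev z j).
  by apply/funext => m; exact: theta_partialE.
apply: cvg_prod; exact: theta_dev_summable.
Qed.

(** An absolutely convergent product vanishes only if one of its factors does. *)
Lemma theta_eq0P z : z != 0 ->
  (theta z p == 0) <-> exists j, z * p ^+ j = 1 \/ z = p ^+ j.
Proof.
move=> z0; split=> [th0|[j zj]]; last first.
  have zero m : (j < m)%N -> theta_partial z m = 0.
    move=> jm; rewrite /theta_partial (big_cat_nat _ (n := j.+1)) //= big_nat_recr //=.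
    case: zj => [->|zj]; first by rewrite subrr mul0r mulr0 mul0r.
    case: j zj {jm} => [|j] zj.
      by rewrite zj !expr0 mulr1 subrr mul0r mulr0 mul0r.
    rewrite big_nat_recr //= -zj mulfV //.
    by rewrite subrr mulr0 mulr0 mul0r mul0r.
  have lim0 : theta_partial z @ \oo --> (0 : K).
    apply: cvg_near_cst; near=> m; apply: zero; near: m.
    exact: nbhs_infty_gt.
  by apply/eqP; exact: limn_unique (@cvg_theta z) lim0.
apply: contrapT => no.
have nz j : 1 + theta_dev z j != 0.
  have -> : 1 + theta_dev z j = (1 - z * p ^+ j) * (1 - p ^+ j.+1 / z).
    by rewrite /theta_dev; ring.
  rewrite mulf_neq0 // subr_eq0 eq_sym; apply/eqP => h; apply: no.
    by exists j; left.
  by exists j.+1; right; rewrite -[RHS](mulfVK z0) h mul1r.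
have := lim_prod_neq0 (@theta_dev_summable z) nz.
rewrite (_ : (fun m => _) = theta_partial z); last first.
  by apply/funext => m; rewrite theta_partialE.
by rewrite (cvg_lim (@norm_hausdorff _ _) (@cvg_theta z)) th0.
Unshelve. all: by end_near. Qed.

Lemma theta1 : theta 1 p = 0.
Proof. by apply/eqP/theta_eq0P; rewrite ?oner_neq0 //; exists 0%N; left; rewrite mulr1. Qed.

(** The zeros are the integral powers of p (only 1, if p = 0), and these are
    closed under division. *)
Lemma theta_div0 z w : z != 0 -> w != 0 ->
  theta z p = 0 -> theta w p = 0 -> theta (z / w) p = 0.
Proof.
move=> z0 w0 /eqP/(theta_eq0P z0)[i hi] /eqP/(theta_eq0P w0)[j hj].
have powneq0 k : (exists2 y, y != 0 & y * p ^+ k = 1 \/ y = p ^+ k) -> p ^+ k != 0.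
  case=> y y0 [h|<-] //; apply: contraTneq isT => h0.
  by move: h; rewrite h0 mulr0 => /eqP; rewrite eq_sym oner_eq0.
have pi0 : p ^+ i != 0 by apply: powneq0; exists z.
have pj0 : p ^+ j != 0 by apply: powneq0; exists w.
apply/eqP/theta_eq0P; first by rewrite mulf_neq0 ?invr_eq0.
have pq k l : p ^+ k != 0 -> p ^+ l != 0 -> exists j0, p ^+ k / p ^+ l * p ^+ j0 = 1 \/ p ^+ k / p ^+ l = p ^+ j0.
  move=> k0 l0; have [kl|lk] := leqP k l.
    by exists (l - k)%N; left; rewrite mulrAC -exprD subnKC // mulfV.
  by exists (k - l)%N; right; rewrite -{1}(subnK (ltnW lk)) exprD mulfK.
case: hi => hi; case: hj => hj.
- rewrite (_ : z / w = p ^+ j / p ^+ i); first exact: pq.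
  by apply/eqP; rewrite eqr_div // hi mulrC hj.
- by exists (i + j)%N; left; rewrite hj exprD mulrACA hi mulVf ?mulr1.
- exists (i + j)%N; right; rewrite hi exprD; congr (_ * _).
  by apply: (mulfI w0); rewrite hj mulfV.
- by rewrite hi hj; exact: pq.
Qed.

Lemma thetaV z : z != 0 -> theta z^-1 p = - z^-1 * theta z p.
Proof.
move=> z0; have [z1|z1] := eqVneq z 1.
  by rewrite z1 invr1 theta1 mulr0.
have pX0 : (fun m => p ^+ m) @ \oo --> 0.
  apply: (@cvg_nm _ _ X _ _ (fun m => nm p ^+ m)) => [m|].
    by rewrite subr0 nmX.
  by apply: cvg_expr; rewrite ger0_norm ?nm_ge0 ?nmp_lt1.
(* Passing from z to its inverse shifts both families of factors by one, so
   that only boundary factors differ; those of index m tend to 1. *)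
have fin m : theta_partial z^-1 m * ((1 - z) * (1 - p ^+ m / z))
           = theta_partial z m * ((1 - z^-1) * (1 - z * p ^+ m)).
  elim: m => [|m IH]; first by rewrite /theta_partial !big_geq // expr0; ring.
  rewrite /theta_partial !big_nat_recr //= -!/(theta_partial _ _).
  transitivity (theta_partial z^-1 m * ((1 - z) * (1 - p ^+ m / z)) * ((1 - z * p ^+ m.+1) * (1 - p ^+ m.+1 / z))).
    by rewrite invrK; ring.
  by rewrite IH; ring.
have l1 : (fun m => theta_partial z^-1 m * ((1 - z) * (1 - p ^+ m / z))) @ \oo
    --> theta z^-1 p * ((1 - z) * (1 - 0 / z)).
  apply: cvgM; first exact: cvg_theta.
  by apply: cvgM; [exact: cvg_cst|apply: cvgB; [exact: cvg_cst|apply: cvgM => //; exact: cvg_cst]].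
have l2 : (fun m => theta_partial z m * ((1 - z^-1) * (1 - z * p ^+ m))) @ \oo
    --> theta z p * ((1 - z^-1) * (1 - z * 0)).
  apply: cvgM; first exact: cvg_theta.
  by apply: cvgM; [exact: cvg_cst|apply: cvgB; [exact: cvg_cst|apply: cvgM => //; exact: cvg_cst]].
move: l1; under eq_fun do rewrite fin; move=> l1.
have := limn_unique l1 l2.
rewrite mul0r mulr0 !subr0 !mulr1 => h.
have z1' : 1 - z != 0 by rewrite subr_eq0 eq_sym.
by apply: (mulIf z1'); rewrite h; field.
Qed.

End ThetaProduct.

(** * The terms of the Jacobi series *)

(** The exponent k (k - 1) / 2 of the Jacobi series, in nat because it is never
    negative. *)
Definition choose2 (k : int) : nat :=
  match k with Posz n => 'C(n, 2) | Negz n => 'C(n.+2, 2) end.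

Lemma bin2E n : (2 * 'C(n, 2) = n * n.-1)%N.
Proof. by rewrite bin2 mul2n halfK -[RHS]subn0; congr (_ - _)%N; case: n => //= n; rewrite oddM /= andNb. Qed.

Lemma choose2E k : 2 * (choose2 k)%:Z = k * (k - 1).
Proof.
by case: k => [[|n]|n] /=; rewrite -?PoszM ?bin2E //= ?NegzE; lia.
Qed.

(** The order of the list makes the next symmetric partial sum differ from the
    previous one by two leading terms. *)
Fixpoint zrange (m : nat) : seq int :=
  if m is m'.+1 then m'.+1%:Z :: - m'.+1%:Z :: zrange m' else [:: 0].

Lemma mem_zrange m k : (k \in zrange m) = (`|k| <= m)%N.
Proof.
elim: m => [|m IH] /=; rewrite !inE; first lia.
rewrite IH; lia.
Qed.

Lemma zrange_uniq m : uniq (zrange m).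
Proof. by elim: m => //= m ->; rewrite inE negb_or !mem_zrange andbT; lia. Qed.

Section JacobiTerms.
Variables (K : fieldType).
Implicit Types (p P w x y : K) (k : int).

Definition jacobi_term P w k : K := P ^+ choose2 k * w ^ k.

(** Both halves of the bilateral series are one-sided series of the same
    Gaussian shape, with arguments w and P / w; this reduces their convergence
    to that of a single type of real series. *)
Lemma jacobi_term_half P w (n : nat) :
  (jacobi_term P w n = P ^+ 'C(n, 2) * w ^+ n) *
  (P != 0 -> jacobi_term P w (- n%:Z) = P ^+ 'C(n, 2) * (P / w) ^+ n).
Proof.
split=> // P0; case: n => [|n]; first by rewrite oppr0.
rewrite -NegzE /jacobi_term /= expr_div_n mulrA -exprD; congr (_ ^+ _ * _).
have := bin2E n.+2; have := bin2E n.+1; rewrite /=; lia.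
Qed.

Let N1_neq0 : (-1 : K) != 0.
Proof. by rewrite oppr_eq0 oner_eq0. Qed.

Let sqrz x k : (x ^+ 2) ^ k = x ^ (2 * k).
Proof. by rewrite [x ^+ 2]exprnP exprz_exp. Qed.

Let sqrX x (n : nat) : (x ^+ 2) ^+ n = x ^ (2 * n%:Z).
Proof. by rewrite -exprM exprnP PoszM. Qed.

Let expN1_even k : (-1 : K) ^ (2 * k) = 1.
Proof. by rewrite -exprz_exp -exprnP sqrrN expr1n exp1rz. Qed.

(** With k = i + j and l = i - j the sum of the exponents k (k - 1) / 2 and
    l (l - 1) / 2 is i (i - 1) + j ^ 2, so that the variables i and j separate
    and p is replaced by its square. *)
Lemma jacobi_term_even p x y i j : p != 0 -> x != 0 -> y != 0 ->
  jacobi_term p (- (x * y)) (i + j) * jacobi_term p (- (x / y)) (i - j) =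
  jacobi_term (p ^+ 2) (x ^+ 2) i * jacobi_term (p ^+ 2) (p * y ^+ 2) j.
Proof.
move=> p0 x0 y0; rewrite /jacobi_term -[- (x * y)]mulN1r -[- (x / y)]mulN1r.
rewrite !(expfzMl (-1)) ?(expfzMl p) ?(expfzMl (p ^+ 2)) !sqrz !(expfzMl x) !sqrX exprz_inv.
rewrite (exprnP p (choose2 _)) (exprnP p (choose2 (i - j))).
transitivity (p ^ ((choose2 (i + j))%:Z + (choose2 (i - j))%:Z) * (-1) ^ (2 * i) *
    (x ^ (2 * i) * y ^ (2 * j))).
  rewrite (_ : 2 * i = (i + j) + (i - j)); last by lia.
  rewrite (_ : 2 * j = (i + j) - (i - j)); last by lia.
  by rewrite !(expfzDr _ _ N1_neq0) !(expfzDr _ _ x0) !(expfzDr _ _ y0) (expfzDr _ _ p0); ring.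
rewrite expN1_even mulr1.
have -> : (choose2 (i + j))%:Z + (choose2 (i - j))%:Z = 2 * (choose2 i)%:Z + (2 * (choose2 j)%:Z + j).
  apply: (@mulfI _ (2 : int)) => //; rewrite !mulrDr !choose2E.
  ring.
rewrite !(expfzDr _ _ p0); ring.
Qed.

(** The pairs (k, l) of opposite parity: the exponents now add up to
    i ^ 2 + j (j + 1), which separates as well, up to a sign. *)
Lemma jacobi_term_odd p x y i j : p != 0 -> x != 0 -> y != 0 ->
  jacobi_term p (- (x * y)) (i + j + 1) * jacobi_term p (- (x / y)) (i - j) =
  - (x * jacobi_term (p ^+ 2) (p * x ^+ 2) i * (y * jacobi_term (p ^+ 2) (p ^+ 2 * y ^+ 2) j)).
Proof.
move=> p0 x0 y0; rewrite /jacobi_term -[- (x * y)]mulN1r -[- (x / y)]mulN1r.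
rewrite !(expfzMl (-1)) ?(expfzMl p) ?(expfzMl (p ^+ 2)) !sqrz !(expfzMl x) !sqrX exprz_inv.
rewrite (exprnP p (choose2 _)) (exprnP p (choose2 (i - j))).
transitivity (p ^ ((choose2 (i + j + 1))%:Z + (choose2 (i - j))%:Z) * ((-1) ^ (2 * i) * (-1)) *
    (x ^ (2 * i) * x * (y ^ (2 * j) * y))).
  rewrite (_ : (-1) ^ (2 * i) * -1 = (-1) ^ ((i + j + 1) + (i - j))); last first.
    by rewrite -{2}[-1]expr1z -expfzDr //; congr (_ ^ _); lia.
  rewrite (_ : x ^ (2 * i) * x = x ^ ((i + j + 1) + (i - j))); last first.
    by rewrite -{2}[x]expr1z -expfzDr //; congr (_ ^ _); lia.
  rewrite (_ : y ^ (2 * j) * y = y ^ ((i + j + 1) - (i - j))); last first.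
    by rewrite -{2}[y]expr1z -expfzDr //; congr (_ ^ _); lia.
  by rewrite !(expfzDr _ (i - j) N1_neq0) !(expfzDr _ (i - j) x0) !(expfzDr _ (- (i - j)) y0) (expfzDr _ _ p0); ring.
rewrite expN1_even mul1r.
have -> : (choose2 (i + j + 1))%:Z + (choose2 (i - j))%:Z = (2 * (choose2 i)%:Z + i) + (2 * (choose2 j)%:Z + 2 * j).
  apply: (@mulfI _ (2 : int)) => //; rewrite !mulrDr !choose2E.
  ring.
by rewrite !(expfzDr _ _ p0); ring.
Qed.

Lemma jacobi_term_shift p x i : p != 0 -> x != 0 ->
  jacobi_term (p ^+ 2) (x ^+ 2) (i + 1) = x ^+ 2 * jacobi_term (p ^+ 2) (p ^+ 2 * x ^+ 2) i.
Proof.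
move=> p0 x0; rewrite /jacobi_term (expfzMl (p ^+ 2)) !sqrz !sqrX.
have -> : 2 * (choose2 (i + 1))%:Z = 2 * (choose2 i)%:Z + 2 * i by rewrite !choose2E; ring.
rewrite mulrDr mulr1 !(expfzDr _ _ p0) !(expfzDr _ _ x0); ring.
Qed.

End JacobiTerms.

(** * Convergence of the Jacobi series *)

Section JacobiSums.
Variables (R : realType) (K : numFieldType) (X : complex_over R K).
Local Notation nm := (nm X).
Implicit Types (p w x y z : K).

Definition jacobi_sum p w (m : nat) : K := \sum_(k <- zrange m) jacobi_term p w k.
Definition jacobi_abs_sum p w (m : nat) : R := \sum_(k <- zrange m) nm (jacobi_term p w k).

(** Consecutive terms have ratio s r ^ n, which is at most 1 from some rank J
    on; the sum of the first terms is a bound. *)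
Lemma gauss_bounded (r s : R) : 0 <= r < 1 -> 0 <= s ->
  exists2 B, 0 <= B & forall n, r ^+ 'C(n, 2) * s ^+ n <= B.
Proof.
move=> /andP[r0 r1] s0.
have e0 n : 0 <= r ^+ 'C(n, 2) * s ^+ n by rewrite mulr_ge0 ?exprn_ge0.
have [J hJ] : exists J, forall n, (J <= n)%N -> s * r ^+ n <= 1.
  have : (fun n => s * r ^+ n) @ \oo --> s * 0.
    by apply: cvgM; [exact: cvg_cst|apply: cvg_expr; rewrite ger0_norm].
  rewrite mulr0 => /cvgr0_norm_lt /(_ _ ltr01) [J _ hJ].
  by exists J => n Jn; apply/ltW/(le_lt_trans (ler_norm _))/hJ.
exists (\sum_(0 <= i < J.+1) r ^+ 'C(i, 2) * s ^+ i).
  by apply: sumr_ge0 => i _.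
elim=> [|n IH].
  by rewrite big_nat_recl // lerDl sumr_ge0.
have [nJ|Jn] := ltnP n.+1 J.+1.
  rewrite (big_rem n.+1) /=; last by rewrite mem_index_iota.
  by rewrite lerDl sumr_ge0.
apply: le_trans IH; rewrite binS bin1 exprD exprS.
rewrite -mulrA ler_wpM2l ?exprn_ge0 // mulrA [_ * s]mulrC.
by rewrite ler_piMl ?exprn_ge0 //; apply: hJ.
Qed.

(** Boundedness for 2 s in place of s gives domination by a geometric series of
    ratio 1/2 for s itself. *)
Lemma gauss_summable (r s : R) : 0 <= r < 1 -> 0 <= s ->
  cvgn (series (fun n => r ^+ 'C(n, 2) * s ^+ n)).
Proof.
move=> r01 s0; have /andP[r0 r1] := r01.
have [B B0 hB] := gauss_bounded r01 (mulr_ge0 (ler0n _ 2) s0).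
apply: (@series_le_cvg _ _ (fun n => B * (2^-1) ^+ n)) => [n|n|n|].
- by rewrite mulr_ge0 ?exprn_ge0.
- by rewrite mulr_ge0 ?exprn_ge0 ?invr_ge0.
- rewrite exprVn ler_pdivlMr ?exprn_gt0 // -mulrA -exprMn [s * 2]mulrC; exact: hB.
- by apply: is_cvg_geometric_series; rewrite ger0_norm ?invr_ge0 // invf_lt1 // ltr1n.
Qed.

Lemma jacobi_abs_sumS p w m : jacobi_abs_sum p w m.+1 = jacobi_abs_sum p w m +
  (nm (jacobi_term p w m.+1) + nm (jacobi_term p w (- m.+1%:Z))).
Proof. by rewrite /jacobi_abs_sum /= !big_cons; ring. Qed.

Lemma jacobi_sumS p w m : jacobi_sum p w m.+1 = jacobi_sum p w m +
  (jacobi_term p w m.+1 + jacobi_term p w (- m.+1%:Z)).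
Proof. by rewrite /jacobi_sum /= !big_cons; ring. Qed.

Variable p : K.
Hypothesis p_lt1 : `|p| < 1.
Hypothesis p_neq0 : p != 0.

Lemma jacobi_abs_sumE w m : jacobi_abs_sum p w m = series (fun n => nm p ^+ 'C(n, 2) * nm w ^+ n) m.+1
   + series (fun n => nm p ^+ 'C(n, 2) * nm (p / w) ^+ n) m.+1 - 1.
Proof.
have h (n : nat) : (nm (jacobi_term p w n) = nm p ^+ 'C(n, 2) * nm w ^+ n) *
   (nm (jacobi_term p w (- n%:Z)) = nm p ^+ 'C(n, 2) * nm (p / w) ^+ n).
  have [-> /(_ p_neq0) ->] := jacobi_term_half p w n.
  by rewrite !nmM !nmX nmM.
elim: m => [|m IH].
  by rewrite /jacobi_abs_sum /= big_seq1 (h 0%N) /series /= !big_nat1 bin0n !expr0; ring.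
rewrite jacobi_abs_sumS IH !h /series /=.
rewrite [X in _ = X + _ - _]big_nat_recr // [X in _ = _ + X - _]big_nat_recr //=; ring.
Qed.

Lemma is_cvg_jacobi_abs_sum w : cvgn (jacobi_abs_sum p w).
Proof.
have -> : jacobi_abs_sum p w = fun m => series (fun n => nm p ^+ 'C(n, 2) * nm w ^+ n) m.+1
   + series (fun n => nm p ^+ 'C(n, 2) * nm (p / w) ^+ n) m.+1 - 1.
  by apply/funext => m; exact: jacobi_abs_sumE.
have key v : cvgn (fun m => series (fun n => nm p ^+ 'C(n, 2) * nm v ^+ n) m.+1).
  have /cvg_ex[/= l hl] : cvgn (series (fun n => nm p ^+ 'C(n, 2) * nm v ^+ n)).
    by apply: gauss_summable; rewrite ?nm_ge0 ?nmp_lt1.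
  by apply/cvg_ex; exists l; move: hl; rewrite -cvg_shiftS.
by apply: is_cvgD; [apply: is_cvgD; exact: key|exact: is_cvg_cst].
Qed.

Lemma jacobi_abs_sum_nondecreasing w : nondecreasing_seq (jacobi_abs_sum p w).
Proof.
by apply/nondecreasing_seqP => m; rewrite jacobi_abs_sumS lerDl addr_ge0 ?nm_ge0.
Qed.

Lemma jacobi_abs_sum_le w : exists2 B, 0 <= B & forall m, jacobi_abs_sum p w m <= B.
Proof.
exists (limn (jacobi_abs_sum p w)) => [|m]; last first.
  by apply: nondecreasing_cvgn_le; [exact: jacobi_abs_sum_nondecreasing|exact: is_cvg_jacobi_abs_sum].
apply: le_trans (nondecreasing_cvgn_le (jacobi_abs_sum_nondecreasing w) (@is_cvg_jacobi_abs_sum w) 0%N).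
by apply: sumr_ge0 => *; exact: nm_ge0.
Qed.

Lemma cvg_jacobi_abs_sumB w : (fun m => jacobi_abs_sum p w m.+1 - jacobi_abs_sum p w m) @ \oo --> (0 : R).
Proof.
have /cvg_ex[/= l hl] := @is_cvg_jacobi_abs_sum w.
by rewrite -(subrr l); apply: cvgB => //; move: hl; rewrite -cvg_shiftS.
Qed.

Lemma is_cvg_jacobi_sum w : cvgn (jacobi_sum p w).
Proof.
apply: (@cvg_of_abs_increments _ _ X _ (fun n => jacobi_abs_sum p w n.+1 - jacobi_abs_sum p w n)) => [n|].
  by rewrite jacobi_sumS jacobi_abs_sumS ![_ + (_ + _)]addrC !addrK; exact: nmD.
have -> : series (fun n => jacobi_abs_sum p w n.+1 - jacobi_abs_sum p w n) = fun n => jacobi_abs_sum p w n - jacobi_abs_sum p w 0%N.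
  by apply/funext => n; rewrite /series /= telescope_sumr.
by apply: is_cvgB; [exact: is_cvg_jacobi_abs_sum|exact: is_cvg_cst].
Qed.

End JacobiSums.

(** * The Jacobi triple product *)

Lemma cvg_ext (K : numFieldType) (f g : nat -> K) (l : K) :
  (forall n, f n = g n) -> f @ \oo --> l -> g @ \oo --> l.
Proof. by move=> /funext ->. Qed.

Section TripleProduct.
Variables (R : realType) (K : numFieldType) (X : complex_over R K).
Local Notation nm := (nm X).
Implicit Types (w x y z : K).
Variable p : K.
Hypothesis p_lt1 : `|p| < 1.
Hypothesis p_neq0 : p != 0.

(** The factors are written 1 + u i, the form in which the lemmas on infinite
    products apply. *)
Definition euler (n : nat) : K := \prod_(0 <= i < n) (1 + - p ^+ i.+1).

Lemma eulerS n : euler n.+1 = euler n * (1 - p ^+ n.+1).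
Proof. by rewrite /euler big_nat_recr. Qed.

Lemma euler_factor_neq0 n : 1 + - p ^+ n.+1 != 0.
Proof.
rewrite subr_eq0 eq_sym; apply/eqP => h.
have := nmX X p n.+1; rewrite h nm1 => /esym/eqP.
apply/negP; rewrite lt_eqF //; apply: exprn_ilt1; rewrite ?nm_ge0 //.
exact: nmp_lt1.
Qed.

Lemma euler_neq0 n : euler n != 0.
Proof.
elim: n => [|n IH]; first by rewrite /euler big_geq ?oner_neq0.
by rewrite eulerS mulf_neq0 // euler_factor_neq0.
Qed.

Lemma euler_summable : abs_summable X (fun i => - p ^+ i.+1).
Proof.
apply: (@abs_summable_le _ _ _ _ (fun n => 1 * nm p ^+ n)); last exact: geometric_summable.
move=> n; rewrite nmN nmX exprS ler_wpM2r ?exprn_ge0 ?nm_ge0 //.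
by apply/ltW/nmp_lt1.
Qed.

Definition euler_oo : K := limn euler.

Lemma cvg_euler : euler @ \oo --> euler_oo.
Proof. exact: cvg_prod euler_summable. Qed.

Lemma euler_oo_neq0 : euler_oo != 0.
Proof. exact: lim_prod_neq0 euler_summable euler_factor_neq0. Qed.

(** The Gaussian binomial coefficient in base p. *)
Definition gbin n k : K := euler n / (euler k * euler (n - k)).

Lemma gbin0 n : gbin n 0 = 1.
Proof. by rewrite /gbin subn0 [euler 0]/euler big_geq // mul1r mulfV // euler_neq0. Qed.

Lemma gbinn n : gbin n n = 1.
Proof. by rewrite /gbin subnn [euler 0]/euler big_geq // mulr1 mulfV // euler_neq0. Qed.

Lemma gbin_pascal n k : (k < n)%N ->
  gbin n.+1 k.+1 = gbin n k.+1 + gbin n k * p ^+ (n - k).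
Proof.
move=> kn; have [d nE] : exists d, n = (k + d.+1)%N by exists (n - k.+1)%N; lia.
rewrite nE /gbin; have -> : ((k + d.+1).+1 - k.+1 = d.+1)%N by lia.
have -> : (k + d.+1 - k.+1 = d)%N by lia.
have -> : (k + d.+1 - k = d.+1)%N by lia.
rewrite !(eulerS k) !(eulerS d) (eulerS (k + d.+1)) -addSn exprD.
have := euler_neq0 k; have := euler_neq0 d; have := euler_factor_neq0 k.
have := euler_factor_neq0 d => h1 h2 h3 h4; field.
by rewrite h1 h2 h3 h4.
Qed.

Lemma qbinomial n w :
  \prod_(0 <= i < n) (1 + w * p ^+ i) =
  \sum_(0 <= k < n.+1) gbin n k * p ^+ 'C(k, 2) * w ^+ k.
Proof.
elim: n => [|n IH].
  by rewrite big_geq // big_nat1 gbin0 bin0n !expr0 !mulr1.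
rewrite big_nat_recr //= IH mulrDr mulr1.
rewrite [in RHS]big_nat_recr //= [in RHS]big_nat_recl //=.
rewrite [X in X + _]big_nat_recl //= [X in _ + X * _]big_nat_recr //=.
rewrite !gbin0 !gbinn [in RHS]binS bin1 exprD.
have -> : \sum_(0 <= i < n) gbin n.+1 i.+1 * p ^+ 'C(i.+1, 2) * w ^+ i.+1 =
  \sum_(0 <= i < n) gbin n i.+1 * p ^+ 'C(i.+1, 2) * w ^+ i.+1 +
  (\sum_(0 <= i < n) gbin n i * p ^+ 'C(i, 2) * w ^+ i) * (w * p ^+ n).
  rewrite mulr_suml -big_split /=; apply: eq_big_nat => i /andP[_ lein].
  rewrite gbin_pascal // binS bin1 exprD exprS -[in p ^+ n](subnK (ltnW lein)) exprD; ring.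
rewrite exprS; ring.
Qed.

(** The coefficient of the k-th term in the finite triple product, that is, the
    Gaussian binomial coefficient of 2 m and m + k normalised so as to tend to
    1 with m. *)
Definition jcoef m (k : int) : K := euler m ^+ 2 / (euler (absz (m%:Z + k)) * euler (absz (m%:Z - k))).

(** Each factor 1 - p ^ (j + 1) / z is a multiple of 1 - z / p ^ (j + 1), so
    that the two families of factors merge into 2 m consecutive ones. *)
Lemma theta_partial_mul z m : z != 0 ->
  theta_partial p z m * \prod_(0 <= j < m) (- z / p ^+ j.+1) =
  \prod_(0 <= i < m + m) (1 + (- z / p ^+ m) * p ^+ i).
Proof.
move=> z0; rewrite [RHS](big_cat_nat _ (n := m)) //= ?leq_addr //.
rewrite -[X in _ = _ * \prod_(X <= _ < _) _]add0n big_addn addnK.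
rewrite [X in _ = X * _]big_nat_rev /= -!big_split /=.
apply: eq_big_nat => i /andP[_ im]; rewrite add0n.
have -> : - z / p ^+ m * p ^+ (m - i.+1) = - z / p ^+ i.+1.
  by rewrite -[in p ^+ m](subnK im) exprD; field; rewrite !expf_neq0.
have -> : - z / p ^+ m * p ^+ (i + m) = - z * p ^+ i.
  by rewrite exprD; field; rewrite !expf_neq0.
by rewrite exprS; field; rewrite expf_neq0 ?p_neq0.
Qed.

(** The q-binomial theorem with 2 m factors, its summation index re-centred
    at m. *)
Lemma jacobi_finite z m : z != 0 ->
  theta_partial p z m * (euler m ^+ 2 / euler (m + m)) =
  \sum_(k <- zrange m) jcoef m k * jacobi_term p (- z) k.
Proof.
move=> z0.
have pm0 : \prod_(0 <= j < m) (- z / p ^+ j.+1) != 0.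
  by rewrite prodf_seq_neq0; apply/allP => i _ /=; rewrite mulf_neq0 ?oppr_eq0 ?invr_eq0 ?expf_neq0.
apply: (mulIf pm0); rewrite mulrAC theta_partial_mul // qbinomial.
have -> : \sum_(k <- zrange m) jcoef m k * jacobi_term p (- z) k =
   \sum_(0 <= i < (m + m).+1) jcoef m (i%:Z - m%:Z) * jacobi_term p (- z) (i%:Z - m%:Z).
  rewrite -[in RHS](big_map (fun i : nat => i%:Z - m%:Z) xpredT (fun k => jcoef m k * jacobi_term p (- z) k)).
  apply: perm_big; apply: uniq_perm; rewrite ?zrange_uniq //.
    by rewrite map_inj_uniq ?iota_uniq // => i j; lia.
  move=> k; rewrite mem_zrange; apply/idP/mapP => [km|[j]].
    by exists (absz (k + m%:Z)); rewrite ?mem_index_iota; lia.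
  by rewrite mem_index_iota; lia.
rewrite !mulr_suml; apply: eq_big_nat => i /andP[_ im].
rewrite /gbin /jcoef.
have -> : absz (m%:Z + (i%:Z - m%:Z))%R = i by lia.
have -> : absz (m%:Z - (i%:Z - m%:Z))%R = (m + m - i)%N by lia.
have -> : \prod_(0 <= j < m) (- z / p ^+ j.+1) = (- z) ^+ m / p ^+ 'C(m.+1, 2).
  elim: (m) => [|k IH]; first by rewrite big_geq // bin_small // !expr0 divr1.
  by rewrite big_nat_recr //= IH [in RHS]binS bin1 [in RHS]exprS [in RHS]exprD; field; rewrite !expf_neq0.
have -> : (- z / p ^+ m) ^+ i = jacobi_term p (- z) (i%:Z - m%:Z) * ((- z) ^+ m / p ^+ 'C(m.+1, 2)) / p ^+ 'C(i, 2).
  have ez : (- z) ^ (i%:Z - m%:Z) * (- z) ^+ m = (- z) ^+ i.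
    by rewrite [(- z) ^+ m]exprnP -expfzDr ?oppr_eq0 // subrK.
  have ep : p ^+ choose2 (i%:Z - m%:Z) * p ^+ (m * i) = p ^+ 'C(i, 2) * p ^+ 'C(m.+1, 2).
    rewrite -!exprD; congr (_ ^+ _).
    have := choose2E (i%:Z - m%:Z); have := bin2E i; have := bin2E m.+1.
    by case: (i) im => [|i'] _ /=; nia.
  rewrite /jacobi_term expr_div_n -exprM -[in LHS]ez.
  have -> : p ^+ choose2 (i%:Z - m%:Z) = p ^+ 'C(i, 2) * p ^+ 'C(m.+1, 2) / p ^+ (m * i).
    by rewrite -ep mulfK // expf_neq0.
  by field; rewrite !expf_neq0.
have := euler_neq0 i; have := euler_neq0 (m + m).
have := euler_neq0 (m + m - i) => h1 h2 h3; field.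
by rewrite h1 h2 h3 !expf_neq0.
Qed.

Lemma euler_cauchy : exists2 D, 0 <= D &
  forall m d, nm (euler (m + d) - euler m) <= D * nm p ^+ m.
Proof.
have [B B0 hB] := partial_prod_bounded euler_summable.
have r1 := nmp_lt1 X p_lt1; have r0 := nm_ge0 X p.
have r1' : 0 < 1 - nm p by rewrite subr_gt0.
exists (B / (1 - nm p)) => [|m d]; first by rewrite divr_ge0 ?ltW.
apply: (@le_trans _ _ (B / (1 - nm p) * nm p ^+ m * (1 - nm p ^+ d))); last first.
  by rewrite ler_piMr ?lerBlDr ?lerDl ?exprn_ge0 // mulr_ge0 ?exprn_ge0 // divr_ge0 ?ltW.
elim: d => [|d IH]; first by rewrite addn0 subrr nm0 expr0 subrr mulr0.
rewrite addnS eulerS (_ : _ - euler m = (euler (m + d) - euler m) - euler (m + d) * p ^+ (m + d).+1); last by ring.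
apply: (le_trans (nmD _ _ _)); rewrite nmN nmM nmX.
apply: (@le_trans _ _ (B / (1 - nm p) * nm p ^+ m * (1 - nm p ^+ d) + B * nm p ^+ (m + d))).
  apply: lerD => //; apply: ler_pM; rewrite ?nm_ge0 ?exprn_ge0 //; first exact: hB.
  by rewrite exprS ler_piMl ?exprn_ge0 // ltW.
rewrite exprD exprS le_eqVlt; apply/orP; left; apply/eqP; field.
by rewrite gt_eqF.
Qed.

Lemma euler_inv_bounded : exists2 M, 0 <= M & forall n, nm (euler n)^-1 <= M.
Proof.
have : cvgn (fun n => (euler n)^-1).
  apply/cvg_ex; exists euler_oo^-1; apply: cvgV; [exact: euler_oo_neq0|exact: cvg_euler].
move=> /cvg_seq_bounded [M [Mr hM]].
exists (nm M + 1) => [|n]; first by rewrite addr_ge0 ?nm_ge0.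
have := hM (`|M| + 1); rewrite (le_lt_trans (real_ler_norm Mr)) ?ltrDl ?ltr01 //.
by move=> /(_ isT n I) /=; rewrite !(nmE X) -(rmorph1 (emb X)) -rmorphD emb_le.
Qed.

(** Three partial products of the same convergent product are compared. The
    bound degrades with |k|, at a rate that the Gaussian decay of the terms
    makes up for. *)
Lemma jcoef_close : exists2 C, 0 <= C & forall m k, (absz k <= m)%N ->
  nm (jcoef m k - 1) <= C * nm p ^+ (m - absz k).
Proof.
have [B B0 hB] := partial_prod_bounded euler_summable.
have [D D0 hD] := euler_cauchy; have [M M0 hM] := euler_inv_bounded.
have r1 := nmp_lt1 X p_lt1; have r0 := nm_ge0 X p.
exists (M * M * (B * D + B * D)) => [|m k km].
  by rewrite mulr_ge0 ?mulr_ge0 ?addr_ge0 ?mulr_ge0 // ltW.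
have -> : jcoef m k = euler m ^+ 2 / (euler (m + absz k) * euler (m - absz k)).
  rewrite /jcoef; congr (_ / _); case: k km => k km.
    have e1 : absz (m%:Z + k%:Z)%R = (m + k)%N by lia.
    have e2 : absz (m%:Z - k%:Z)%R = (m - k)%N by lia.
    by rewrite e1 e2.
  have e1 : absz (m%:Z + Negz k)%R = (m - absz (Negz k))%N by lia.
  have e2 : absz (m%:Z - Negz k)%R = (m + absz (Negz k))%N by lia.
  by rewrite e1 e2 mulrC.
set l := absz k in km *.
have -> : euler m ^+ 2 / (euler (m + l) * euler (m - l)) - 1 =
  (euler (m + l))^-1 * (euler (m - l))^-1 *
  (euler m * (euler m - euler (m - l)) - euler (m - l) * (euler (m + l) - euler m)).
  by field; rewrite !euler_neq0.
rewrite nmM nmM -mulrA; rewrite -!mulrA ler_pM ?nm_ge0 ?mulr_ge0 ?nm_ge0 //.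
rewrite ler_pM ?nm_ge0 ?mulr_ge0 ?nm_ge0 //.
apply: (le_trans (nmD _ _ _)); rewrite nmN !nmM mulrDl lerD //.
  rewrite -mulrA ler_pM ?nm_ge0 //; first exact: hB.
  by have := hD (m - l)%N l; rewrite subnK.
rewrite -mulrA ler_pM ?nm_ge0 //; first exact: hB.
apply: (le_trans (hD _ _)); rewrite ler_wpM2l //.
by apply: ler_wiXn2l; rewrite ?leq_subr // ltW.
Qed.

(** The limit of the finite identity. By jcoef_close the difference with the
    partial sum of the series is at most a multiple of |p| ^ m times a sum of
    |p| ^ (- |k|) |term k|; the latter stays bounded because it is dominated by
    the same absolutely convergent series at z / p and at z p. *)
Lemma jacobi_triple_product z : z != 0 ->
  jacobi_sum p (- z) @ \oo --> theta z p * euler_oo.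
Proof.
move=> z0.
have [C C0 hC] := jcoef_close.
have [B1 B10 hB1] := jacobi_abs_sum_le X p_lt1 p_neq0 (- z / p).
have [B2 B20 hB2] := jacobi_abs_sum_le X p_lt1 p_neq0 (- z * p).
have r1 := nmp_lt1 X p_lt1; have r0 := nm_ge0 X p.
have rp : 0 < nm p by rewrite nm_gt0.
have close : (fun m => theta_partial p z m * (euler m ^+ 2 / euler (m + m)) - jacobi_sum p (- z) m) @ \oo --> (0 : K).
  apply: (@cvg_nm _ _ X _ _ (fun m => C * (B1 + B2) * nm p ^+ m)) => [m|]; last first.
    rewrite -[X in _ --> X](mulr0 (C * (B1 + B2))); apply: cvgM; first exact: cvg_cst.
    by apply: cvg_expr; rewrite ger0_norm.
  rewrite subr0 jacobi_finite // /jacobi_sum -sumrB; apply: (le_trans (nm_sum _ _ _ _)).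
  apply: (@le_trans _ _ (\sum_(k <- zrange m) C * nm p ^+ m * (nm (jacobi_term p (- z / p) k) + nm (jacobi_term p (- z * p) k)))).
    rewrite big_seq_cond [leRHS]big_seq_cond; apply: ler_sum => k; rewrite andbT mem_zrange => km.
    rewrite -[X in _ - X]mul1r -mulrBl nmM.
    apply: (le_trans (ler_wpM2r (nm_ge0 _ _) (hC _ _ km))).
    rewrite -!mulrA ler_wpM2l //.
    have -> : nm p ^+ (m - absz k) = nm p ^+ m * (nm p ^+ absz k)^-1.
      by rewrite -{2}(subnK km) exprD mulfK // expf_neq0 // gt_eqF.
    rewrite -mulrA ler_wpM2l ?exprn_ge0 // /jacobi_term !nmM.
    case: k km => k _ /=.
      apply: ler_wpDr; first by rewrite mulr_ge0 ?nm_ge0.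
      by rewrite -!exprnP !nmX nmM nmV mulrCA ler_wpM2l ?exprn_ge0 ?nm_ge0 // expr_div_n mulrC.
    apply: ler_wpDl; first by rewrite mulr_ge0 ?nm_ge0.
    rewrite NegzE -!exprnN !nmV !nmX nmM mulrCA ler_wpM2l ?exprn_ge0 ?nm_ge0 //.
    by rewrite exprMn invfM mulrC.
  rewrite -mulr_sumr big_split /= -!mulrA ler_wpM2l // mulrC ler_wpM2r ?exprn_ge0 //.
  by apply: lerD; [exact: hB1|exact: hB2].
have main : (fun m => theta_partial p z m * (euler m ^+ 2 / euler (m + m))) @ \oo --> theta z p * euler_oo.
  apply: cvgM; first exact: (@cvg_theta _ _ X p p_lt1 z).
  have -> : euler_oo = euler_oo * euler_oo / euler_oo by rewrite mulfK // euler_oo_neq0.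
  apply: cvgM.
    by under eq_fun do rewrite expr2; apply: cvgM; exact: cvg_euler.
  apply: cvgV; first exact: euler_oo_neq0.
  have [D D0 hD] := euler_cauchy.
  have diff : (fun m => euler (m + m) - euler m) @ \oo --> (0 : K).
    apply: (@cvg_nm _ _ X _ _ (fun m => D * nm p ^+ m)) => [m|].
      by rewrite subr0; exact: hD.
    rewrite -[X in _ --> X](mulr0 D); apply: cvgM; first exact: cvg_cst.
    by apply: cvg_expr; rewrite ger0_norm.
  have h := @cvgD _ _ _ _ _ _ _ _ _ diff cvg_euler; rewrite add0r in h.
  refine (@cvg_ext K _ _ _ _ (h _)) => m.
  by rewrite fctE subrK.
have h := @cvgB _ _ _ _ _ _ _ _ _ main close; rewrite subr0 in h.
refine (@cvg_ext K _ _ _ _ (h _)) => m.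
by rewrite !fctE subKr.
Qed.

End TripleProduct.

(** * The three-term theta relation *)

Section ThreeTerm.
Variables (R : realType) (K : numFieldType) (X : complex_over R K).
Local Notation nm := (nm X).
Implicit Types (w x y z : K).

(** A partial sum squeezed between two others: this compares a product of two
    series, summed along squares, with its summation along diamonds. *)
Lemma sum_sub_nm (T : eqType) (s0 s1 s2 : seq T) (f : T -> K) :
  uniq s0 -> uniq s1 -> uniq s2 -> {subset s0 <= s1} -> {subset s1 <= s2} ->
  nm (\sum_(i <- s2) f i - \sum_(i <- s1) f i) <=
  \sum_(i <- s2) nm (f i) - \sum_(i <- s0) nm (f i).
Proof.
move=> u0 u1 u2 s01 s12.
have part (V : zmodType) (g : T -> V) s : uniq s -> {subset s <= s2} ->
    \sum_(i <- s2) g i - \sum_(i <- s) g i = \sum_(i <- s2 | i \notin s) g i.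
  move=> us ss; rewrite (bigID (mem s)) /= -big_filter.
  have -> : \sum_(i <- [seq i <- s2 | mem s i]) g i = \sum_(i <- s) g i.
    apply: perm_big; apply: uniq_perm; rewrite ?filter_uniq // => i.
    rewrite mem_filter /=; apply/andP/idP => [[]//|si]; split=> //; exact: ss.
  by rewrite addrAC subrr add0r.
rewrite !part // => [|i /s01/s12 //].
apply: (le_trans (nm_sum _ _ _ _)).
rewrite [leRHS](bigID [pred i | i \notin s1]) /=.
have -> : \sum_(i <- s2 | (i \notin s0) && (i \notin s1)) nm (f i) =
          \sum_(i <- s2 | i \notin s1) nm (f i).
  by apply: eq_bigl => i; apply: andb_idl; apply: contra => /s01.
by rewrite lerDl sumr_ge0 // => i _; exact: nm_ge0.
Qed.

Lemma cvg_odd_subseq (V : numFieldType) (f : nat -> V) (l : V) :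
  f @ \oo --> l -> (fun m => f (m + m).+1) @ \oo --> l.
Proof.
move=> h; apply: (cvg_comp (fun m => (m + m).+1) f) h => P [N _ hP].
by exists N => // m /= Nm; apply: hP => /=; lia.
Qed.

Definition square (m : nat) : seq (int * int) := [seq (k, l) | k <- zrange m, l <- zrange m].

(** The pairs (k, l) listed by i and j with k + l = 2 i or 2 i + 1 and
    k - l = 2 j or 2 j + 1, for i and j in a square. *)
Definition diamond (m : nat) : seq (int * int) :=
  [seq (i.1 + i.2, i.1 - i.2) | i <- square m] ++
  [seq (i.1 + i.2 + 1, i.1 - i.2) | i <- square m].

Lemma mem_square m (k l : int) : ((k, l) \in square m) = (absz k <= m)%N && (absz l <= m)%N.
Proof.
by rewrite -!mem_zrange; apply/allpairsP/andP => [[[k' l'] [? ? [-> ->]]]|[? ?]] //; exists (k, l).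
Qed.

Lemma square_uniq m : uniq (square m).
Proof. by apply: allpairs_uniq; rewrite ?zrange_uniq // => -[? ?] [? ?] _ _ [-> ->]. Qed.

Lemma mem_diamond m k l : reflect
  (exists i j, [/\ (absz i <= m)%N, (absz j <= m)%N &
     (k = i + j /\ l = i - j) \/ (k = i + j + 1 /\ l = i - j)])
  ((k, l) \in diamond m).
Proof.
apply: (iffP idP).
  rewrite mem_cat => /orP[] /mapP[[i j]]; rewrite mem_square => /andP[? ?] /= [-> ->];
  exists i, j; split=> //; [by left|by right].
move=> [i [j [im jm h]]]; rewrite mem_cat; apply/orP.
by case: h => -[-> ->]; [left|right]; apply/mapP; exists (i, j); rewrite ?mem_square ?im ?jm.
Qed.

Lemma diamond_uniq m : uniq (diamond m).
Proof.
rewrite cat_uniq !map_inj_uniq ?square_uniq; first last.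
- by move=> [i j] [i' j'] /= [h1 h2]; congr pair; lia.
- by move=> [i j] [i' j'] /= [h1 h2]; congr pair; lia.
rewrite andbT /=; apply/hasPn => -[k l] /mapP[[i j] _ [-> ->]].
by apply/mapP => -[[i' j'] _ [h1 h2]]; lia.
Qed.

Lemma square_sub_diamond m : {subset square m <= diamond m}.
Proof.
move=> [k l]; rewrite mem_square => /andP[km lm]; apply/mem_diamond.
have [q [h|h]] : exists q : int, k + l = 2 * q \/ k + l = 2 * q + 1.
  exists ((k + l) %/ 2)%Z.
  have := divz_eq (k + l) 2; have := modz_ge0 (k + l) (isT : 2 != 0 :> int).
  by have := ltz_pmod (k + l) (isT : 0 < 2 :> int); lia.
- by exists q, (q - l); split; [lia|lia|left; lia].
- by exists q, (q - l); split; [lia|lia|right; lia].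
Qed.

Lemma diamond_sub_square m : {subset diamond m <= square (m + m).+1}.
Proof.
move=> [k l] /mem_diamond[i [j [im jm h]]]; rewrite mem_square.
by case: h => -[-> ->]; lia.
Qed.

Lemma sum_square (V : pzRingType) (f g : int -> V) m :
  \sum_(i <- square m) f i.1 * g i.2 = (\sum_(k <- zrange m) f k) * (\sum_(k <- zrange m) g k).
Proof.
rewrite big_allpairs mulr_suml; apply: eq_bigr => k _.
by rewrite mulr_sumr.
Qed.

Variable p : K.
Hypothesis p_lt1 : `|p| < 1.
Hypothesis p_neq0 : p != 0.

Let p2_lt1 : `|p ^+ 2| < 1.
Proof. by rewrite normrX; apply: exprn_ilt1; rewrite ?normr_ge0. Qed.

Let p2_neq0 : p ^+ 2 != 0.
Proof. exact: expf_neq0. Qed.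

(** The Jacobi series with p replaced by its square and with arguments p y ^ 2,
    respectively p ^ 2 y ^ 2: the two functions whose 2 x 2 determinants are
    products of theta functions. *)
Definition even_theta y : K := limn (jacobi_sum (p ^+ 2) (p * y ^+ 2)).
Definition odd_theta y : K := y * limn (jacobi_sum (p ^+ 2) (p ^+ 2 * y ^+ 2)).

(** A shift of the index costs two boundary terms, which cvg_jacobi_term makes
    negligible. *)
Lemma jacobi_sum_shift w v m :
  (forall k, jacobi_term (p ^+ 2) w (k + 1) = v k) ->
  \sum_(k <- zrange m) v k = jacobi_sum (p ^+ 2) w m + jacobi_term (p ^+ 2) w m.+1 - jacobi_term (p ^+ 2) w (- m%:Z).
Proof.
move=> h; elim: m => [|m IH].
  by rewrite /jacobi_sum /= !big_seq1 -h add0r oppr0; ring.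
rewrite /jacobi_sum /= !big_cons IH -!h.
have -> : - m.+1%:Z + 1 = - m%:Z by lia.
have -> : m.+1%:Z + 1 = m.+2%:Z by lia.
rewrite /jacobi_sum; ring.
Qed.

Lemma cvg_jacobi_term w : (fun m => jacobi_term (p ^+ 2) w m.+1) @ \oo --> (0 : K) /\
  (fun m => jacobi_term (p ^+ 2) w (- m%:Z)) @ \oo --> (0 : K).
Proof.
have h := cvg_jacobi_abs_sumB X p2_lt1 p2_neq0 w.
have lt m : nm (jacobi_term (p ^+ 2) w m.+1) <= jacobi_abs_sum X (p ^+ 2) w m.+1 - jacobi_abs_sum X (p ^+ 2) w m /\
   nm (jacobi_term (p ^+ 2) w (- m.+1%:Z)) <= jacobi_abs_sum X (p ^+ 2) w m.+1 - jacobi_abs_sum X (p ^+ 2) w m.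
  rewrite jacobi_abs_sumS addrAC subrr add0r lerDl lerDr; split; exact: nm_ge0.
split.
  by apply: (cvg_nm (X := X)) h => m; rewrite subr0; case: (lt m).
rewrite -cvg_shiftS.
by apply: (cvg_nm (X := X)) h => m; rewrite subr0; case: (lt m).
Qed.

(** The product of the Jacobi series at x y and x / y, summed along diamonds: by
    jacobi_term_even and jacobi_term_odd the variables x and y separate, into two products
    of one-variable series. *)
Lemma theta_rank_two x y : x != 0 -> y != 0 ->
  euler_oo p ^+ 2 * (theta (x * y) p * theta (x / y) p) =
  x * (odd_theta x * even_theta y - even_theta x * odd_theta y).
Proof.
move=> x0 y0; have xy0 : x * y != 0 by rewrite mulf_neq0.
have xVy0 : x / y != 0 by rewrite mulf_neq0 ?invr_eq0.
pose f k := jacobi_term p (- (x * y)) k; pose g k := jacobi_term p (- (x / y)) k.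
pose A m := \sum_(i <- square (m + m).+1) f i.1 * g i.2.
pose B m := \sum_(i <- diamond m) f i.1 * g i.2.
have AE m : A m = jacobi_sum p (- (x * y)) (m + m).+1 * jacobi_sum p (- (x / y)) (m + m).+1.
  exact: sum_square.
have AB : (fun m => A m - B m) @ \oo --> (0 : K).
  pose S w := jacobi_abs_sum X p w.
  have /cvg_ex[/= l1 h1] : cvgn (S (- (x * y))) by exact: (@is_cvg_jacobi_abs_sum _ _ X _ p_lt1 p_neq0 _).
  have /cvg_ex[/= l2 h2] : cvgn (S (- (x / y))) by exact: (@is_cvg_jacobi_abs_sum _ _ X _ p_lt1 p_neq0 _).
  apply: (@cvg_nm _ _ X _ _ (fun m => S (- (x * y)) (m + m).+1 * S (- (x / y)) (m + m).+1
      - S (- (x * y)) m * S (- (x / y)) m)) => [m|]; last first.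
    rewrite -(subrr (l1 * l2)); apply: cvgB; last exact: cvgM.
    by apply: cvgM; exact: cvg_odd_subseq.
  rewrite subr0 /S /jacobi_abs_sum -!sum_square.
  have := @sum_sub_nm _ _ _ _ (fun i : int * int => f i.1 * g i.2) (square_uniq m) (diamond_uniq m)
     (square_uniq (m + m).+1) (@square_sub_diamond m) (@diamond_sub_square m).
  have E s : \sum_(i <- s) nm (f i.1 * g i.2) = \sum_(i <- s) nm (f i.1) * nm (g i.2).
    by apply: eq_bigr => i _; rewrite nmM.
  by rewrite !E.
have limA : A @ \oo --> (theta (x * y) p * euler_oo p) * (theta (x / y) p * euler_oo p).
  refine (@cvg_ext K _ _ _ (fun m => esym (AE m)) _).
  apply: cvgM; apply: (@cvg_odd_subseq _ (jacobi_sum p _)).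
    exact: (@jacobi_triple_product _ _ X _ p_lt1 p_neq0 _ xy0).
  exact: (@jacobi_triple_product _ _ X _ p_lt1 p_neq0 _ xVy0).
have evenE w : jacobi_sum (p ^+ 2) (p * w ^+ 2) @ \oo --> even_theta w.
  exact: (@is_cvg_jacobi_sum _ _ X _ p2_lt1 p2_neq0 _).
have oddE w : (fun m => w * jacobi_sum (p ^+ 2) (p ^+ 2 * w ^+ 2) m) @ \oo --> odd_theta w.
  by apply: cvgM; [exact: cvg_cst|exact: (@is_cvg_jacobi_sum _ _ X _ p2_lt1 p2_neq0 _)].
have headE : jacobi_sum (p ^+ 2) (x ^+ 2) @ \oo --> x * odd_theta x.
  have E m : x * (x * jacobi_sum (p ^+ 2) (p ^+ 2 * x ^+ 2) m) - jacobi_term (p ^+ 2) (x ^+ 2) m.+1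
      + jacobi_term (p ^+ 2) (x ^+ 2) (- m%:Z) = jacobi_sum (p ^+ 2) (x ^+ 2) m.
    have sh k : jacobi_term (p ^+ 2) (x ^+ 2) (k + 1) = x ^+ 2 * jacobi_term (p ^+ 2) (p ^+ 2 * x ^+ 2) k.
      exact: jacobi_term_shift.
    by rewrite mulrA -expr2 {1}/jacobi_sum mulr_sumr (jacobi_sum_shift _ sh); ring.
  have [c1 c2] := cvg_jacobi_term (x ^+ 2).
  refine (@cvg_ext K _ _ _ E _).
  rewrite -[x * odd_theta x]addr0 -[X in X + 0](subr0); apply: cvgD => //; apply: cvgB => //.
  by apply: cvgM => //; exact: cvg_cst.
have BE m : B m = jacobi_sum (p ^+ 2) (x ^+ 2) m * jacobi_sum (p ^+ 2) (p * y ^+ 2) m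
   - (x * jacobi_sum (p ^+ 2) (p * x ^+ 2) m) * (y * jacobi_sum (p ^+ 2) (p ^+ 2 * y ^+ 2) m).
  rewrite /B /diamond big_cat !big_map /= -sum_square; congr (_ + _).
    by apply: eq_bigr => -[i j] _ /=; exact: jacobi_term_even.
  rewrite /jacobi_sum [x * \sum_(k <- _) _]mulr_sumr [y * \sum_(k <- _) _]mulr_sumr.
  rewrite -sum_square -sumrN.
  by apply: eq_bigr => -[i j] _ /=; exact: jacobi_term_odd.
have limB : B @ \oo --> x * (odd_theta x * even_theta y - even_theta x * odd_theta y).
  have -> : x * (odd_theta x * even_theta y - even_theta x * odd_theta y) =
    x * odd_theta x * even_theta y - x * even_theta x * odd_theta y by ring.
  refine (@cvg_ext K _ _ _ (fun m => esym (BE m)) _).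
  apply: cvgB; apply: cvgM => //; apply: cvgM => //; exact: cvg_cst.
have limB' : B @ \oo --> (theta (x * y) p * euler_oo p) * (theta (x / y) p * euler_oo p).
  have h := @cvgB _ _ _ _ _ _ _ _ _ limA AB; rewrite subr0 in h.
  by refine (@cvg_ext K _ _ _ _ (h _)) => m; rewrite !fctE subKr.
by rewrite -(limn_unique limB' limB); ring.
Qed.

(** Let s be a square root of c. By theta_rank_two, theta (u / v) theta (u v / c)
    is, up to the factor u / s and a constant, the determinant of the vectors
    (odd_theta, even_theta) at u / s and v / s. The claim is then the Pluecker
    relation between the 2 x 2 minors of the four vectors attached to t1, t2,
    D and w. *)
Lemma theta_three_term_generic t1 t2 D w c : t1 != 0 -> t2 != 0 -> D != 0 -> w != 0 -> c != 0 ->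
 theta (t1 / t2) p * theta (t1 * t2 / c) p * (theta (D / w) p * theta (D * w / c) p) =
 theta (t1 / w) p * theta (t1 * w / c) p * (theta (D / t2) p * theta (D * t2 / c) p)
 - (t1 / t2) * (theta (t2 / w) p * theta (t2 * w / c) p * (theta (D / t1) p * theta (D * t1 / c) p)).
Proof.
move=> t10 t20 D0 w0 c0; have [s sc] := has_sqrt X c.
have s0 : s != 0 by apply: contra_neq c0 => s0; rewrite -sc s0 expr0n.
have F u v : u != 0 -> v != 0 ->
  theta (u / v) p * theta (u * v / c) p * euler_oo p ^+ 2 =
  (u / s) * (odd_theta (u / s) * even_theta (v / s) - even_theta (u / s) * odd_theta (v / s)).
  move=> u0 v0; rewrite -theta_rank_two ?mulf_neq0 ?invr_eq0 //.
  have -> : u / s * (v / s) = u * v / c by rewrite -sc; field.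
  have -> : u / s / (v / s) = u / v by field; rewrite v0 s0.
  by ring.
have e0 : euler_oo p != 0 by exact: (euler_oo_neq0 X).
apply: (mulIf (expf_neq0 2 e0)); apply: (mulIf (expf_neq0 2 e0)).
transitivity ((theta (t1 / t2) p * theta (t1 * t2 / c) p * euler_oo p ^+ 2) *
              (theta (D / w) p * theta (D * w / c) p * euler_oo p ^+ 2)).
  by ring.
transitivity ((theta (t1 / w) p * theta (t1 * w / c) p * euler_oo p ^+ 2) *
              (theta (D / t2) p * theta (D * t2 / c) p * euler_oo p ^+ 2) -
  (t1 / t2) * ((theta (t2 / w) p * theta (t2 * w / c) p * euler_oo p ^+ 2) *
              (theta (D / t1) p * theta (D * t1 / c) p * euler_oo p ^+ 2))); last by ring.
by rewrite !F //; field; rewrite t20 s0.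
Qed.

End ThreeTerm.

Lemma theta_three_term (R : realType) (K : numFieldType) (X : complex_over R K) (p : K) :
 `|p| < 1 -> forall t1 t2 D w c : K, t1 != 0 -> t2 != 0 -> D != 0 -> w != 0 -> c != 0 ->
 theta (t1 / t2) p * theta (t1 * t2 / c) p * (theta (D / w) p * theta (D * w / c) p) =
 theta (t1 / w) p * theta (t1 * w / c) p * (theta (D / t2) p * theta (D * t2 / c) p)
 - (t1 / t2) * (theta (t2 / w) p * theta (t2 * w / c) p * (theta (D / t1) p * theta (D * t1 / c) p)).
Proof.
move=> p1 t1 t2 D w c t10 t20 D0 w0 c0.
(* At p = 0, where the Jacobi series in both directions is not available, theta
   is 1 - z and the relation is an identity of rational functions. *)
have [p0|p0] := eqVneq p 0; last exact: (theta_three_term_generic X).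
have th0 z : theta z p = 1 - z.
  rewrite /theta p0.
  have : (fun m => \prod_(0 <= j < m) ((1 - z * 0 ^+ j) * (1 - 0 ^+ j.+1 / z))) @ \oo --> 1 - z.
    apply: cvg_near_cst; near=> m.
    have m0 : (0 < m)%N by near: m; exact: nbhs_infty_gt.
    rewrite -(prednK m0) big_nat_recl //= big1 ?expr0 ?expr1 => [|i _].
      by rewrite mul0r subr0 !mulr1.
    by rewrite !exprS !mul0r mulr0 !subr0 mulr1.
  by move=> h; rewrite (cvg_lim (@norm_hausdorff _ _) h).
by rewrite !th0; field; rewrite t10 t20 w0 c0.
Unshelve. all: by end_near. Qed.
Local Close Scope classical_set_scope.

(** * Elliptic partial fractions *)

(** The summation formulas follow algebraically from these laws. The last one,
    on the zero set, takes the place of a continuity argument when parameters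
    are in special position. *)
Record theta_law (K : fieldType) (th : K -> K) : Prop := ThetaLaw {
  th1 : th 1 = 0;
  thV : forall z, z != 0 -> th z^-1 = - z^-1 * th z;
  th_add : forall t1 t2 s w c, t1 != 0 -> t2 != 0 -> s != 0 -> w != 0 -> c != 0 ->
    th (t1 / t2) * th (t1 * t2 / c) * (th (s / w) * th (s * w / c)) =
    th (t1 / w) * th (t1 * w / c) * (th (s / t2) * th (s * t2 / c))
    - (t1 / t2) * (th (t2 / w) * th (t2 * w / c) * (th (s / t1) * th (s * t1 / c)));
  th_div0 : forall z w, z != 0 -> w != 0 -> th z = 0 -> th w = 0 -> th (z / w) = 0
}.

Section Lagrange.
Variables (K : fieldType) (th : K -> K).
Hypothesis thL : theta_law th.

Lemma thVdiv y z : y != 0 -> z != 0 -> th (y / z) = - (y / z) * th (z / y).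
Proof.
by move=> y0 z0; rewrite -[y / z]invf_div (thV thL) ?mulf_neq0 ?invr_eq0.
Qed.

Variable T : finType.

(** The interpolation, at the nodes t0 and t i, of the function of D given by
    lagrange_lhs; tau is the ratio of the product of the nodes to that of the
    zeros w0 and w i, so that both sides have the same multiplier under
    D |-> p D. *)
Definition lagrange_rhs (I : {set T}) (t w : T -> K) (t0 w0 D tau : K) : K :=
  th (D * tau / t0) * th (t0 / w0) * \prod_(i in I) (th (w i / t0) * (th (t i / D) / th (t i / t0)))
  + \sum_(i in I) th (D * tau / t i) * th (t i / w0) * (th (t0 / D) / th (t0 / t i))
      * \prod_(l in I) th (w l / t i) * \prod_(l in I :\ i) (th (t l / D) / th (t l / t i)).

Definition lagrange_lhs (I : {set T}) (w : T -> K) (w0 D tau : K) : K := th tau * th (D / w0) * \prod_(i in I) th (w i / D).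

(** The functions s |-> th (s / w) th (w' / s) with w w' fixed span a space of
    dimension two. This expands one of them on the two functions that vanish
    at t1 and at t0. *)
Lemma th_split t0 t1 w0 w1 s : t0 != 0 -> t1 != 0 -> w0 != 0 -> w1 != 0 -> s != 0 ->
  th (t0 / t1) * th (t0 * t1 / (w0 * w1)) * (th (s / w0) * th (w1 / s)) =
  w1 / t1 * (th (t0 / w1) * th (t0 / w0)) * (th (s / (w0 * w1 / t1)) * th (t1 / s))
  - w1 / t1 * (th (t1 / w1) * th (t1 / w0)) * (th (s / (w0 * w1 / t0)) * th (t0 / s)).
Proof.
move=> t00 t10 w00 w10 s0.
have := th_add thL t00 t10 s0 w10 (mulf_neq0 w00 w10).
have e u : u * w1 / (w0 * w1) = u / w0 by field; rewrite w10 w00.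
have e' u v : v != 0 -> u / (w0 * w1 / v) = u * v / (w0 * w1).
  by move=> v0; field; rewrite v0 w10 w00.
rewrite !e !e' // (thVdiv w10 s0) (thVdiv t10 s0) (thVdiv t00 s0) => h.
transitivity (- (w1 / s) * (th (t0 / t1) * th (t0 * t1 / (w0 * w1)) * (th (s / w1) * th (s / w0)))).
  by ring.
by rewrite h; field; rewrite s0 t10.
Qed.

Lemma setD1C (A : {set T}) a b : A :\ a :\ b = A :\ b :\ a.
Proof. by apply/setP => i; rewrite !inE andbCA. Qed.

(** Both sides depend linearly on the function f s = th (s / w0) th (w i0 / s),
    all other zeros being fixed. Expanding f by th_split on functions that
    vanish at t i0 and at t0 removes one node, and one zero, from each
    summand. *)
Lemma lagrange_step (I : {set T}) (t w : T -> K) (t0 w0 D tau : K) i0 : i0 \in I ->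
  (forall i, t i != 0) -> (forall i, w i != 0) -> t0 != 0 -> w0 != 0 -> D != 0 ->
  (forall i, i \in I -> th (t0 / t i) != 0) ->
  (forall i j, i \in I -> j \in I -> i != j -> th (t i / t j) != 0) ->
  (forall w0', w0' * t i0 = w0 * w i0 ->
     lagrange_lhs (I :\ i0) w w0' D tau = lagrange_rhs (I :\ i0) t w t0 w0' D tau) ->
  (forall w0', w0' * t0 = w0 * w i0 ->
     lagrange_lhs (I :\ i0) w w0' D tau = lagrange_rhs (I :\ i0) t w (t i0) w0' D tau) ->
  th (t0 * t i0 / (w0 * w i0)) != 0 ->
  lagrange_lhs I w w0 D tau = lagrange_rhs I t w t0 w0 D tau.
Proof.
move=> i0I t_n w_n t00 w00 D0 nz0 nz hA hB good.
have t0i0 : th (t0 / t i0) != 0 by exact: nz0.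
have ti0t0 : th (t i0 / t0) != 0.
  by rewrite thVdiv // mulf_neq0 // oppr_eq0 mulf_neq0 ?invr_eq0.
pose f s := th (s / w0) * th (w i0 / s).
pose Lam (f : K -> K) := th tau * f D * \prod_(l in I :\ i0) th (w l / D)
  - (th (D * tau / t0) * f t0 * \prod_(l in I :\ i0) th (w l / t0)
       * \prod_(l in I) (th (t l / D) / th (t l / t0))
  + \sum_(i in I) th (D * tau / t i) * f (t i) * (th (t0 / D) / th (t0 / t i))
      * \prod_(l in I :\ i0) th (w l / t i) * \prod_(l in I :\ i) (th (t l / D) / th (t l / t i))).
have LamE : Lam f = lagrange_lhs I w w0 D tau - lagrange_rhs I t w t0 w0 D tau.
  have E s : \prod_(i in I) th (w i / s) = th (w i0 / s) * \prod_(l in I :\ i0) th (w l / s).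
    exact: big_setD1.
  rewrite /Lam /lagrange_lhs /lagrange_rhs [X in _ = _ - (_ * X + _)]big_split /= !E /f.
  congr (_ - (_ + _)); try ring.
  by apply: eq_bigr => i iI; rewrite E; ring.
pose cA := w i0 / t i0 * (th (t0 / w i0) * th (t0 / w0)).
pose cB := w i0 / t i0 * (th (t i0 / w i0) * th (t i0 / w0)).
pose wA := w0 * w i0 / t i0; pose wB := w0 * w i0 / t0.
pose fA s := th (s / wA) * th (t i0 / s).
pose fB s := th (s / wB) * th (t0 / s).
have fE s : s != 0 -> th (t0 / t i0) * th (t0 * t i0 / (w0 * w i0)) * f s = cA * fA s - cB * fB s.
  by move=> s0; exact: th_split.
have LamA : Lam fA = 0.
  have wAe : wA * t i0 = w0 * w i0 by rewrite /wA mulfVK.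
  have := hA _ wAe; rewrite /lagrange_lhs /lagrange_rhs => h.
  rewrite /Lam; apply/eqP; rewrite subr_eq0; apply/eqP.
  transitivity (th (t i0 / D) * (th tau * th (D / wA) * \prod_(i in I :\ i0) th (w i / D))).
    by rewrite /fA; ring.
  have fA0 : fA (t i0) = 0 by rewrite /fA divff // (th1 thL) mulr0.
  rewrite h [\prod_(l in I) _](big_setD1 i0 i0I) [\sum_(i in I) _](big_setD1 i0 i0I) /= fA0.
  rewrite mulr0 !mul0r add0r mulrDr; congr (_ + _).
    rewrite big_split /= /fA; set P := \prod_(i in I :\ i0) th _; set Q := \prod_(i in I :\ i0) _.
    by field; exact: ti0t0.
  rewrite mulr_sumr; apply: eq_bigr => i; rewrite !inE => /andP[ii0 iI].
  rewrite [\prod_(l in I :\ i) _](big_setD1 i0) /=; last by rewrite !inE eq_sym ii0.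
  rewrite setD1C /fA; set P := \prod_(l in I :\ i0) _; set Q := \prod_(l in _ :\ _) _.
  have := nz i0 i i0I iI; rewrite eq_sym ii0 => /(_ isT) h1.
  by field; rewrite h1 nz0.
have LamB : Lam fB = 0.
  have wBe : wB * t0 = w0 * w i0 by rewrite /wB mulfVK.
  have := hB _ wBe; rewrite /lagrange_lhs /lagrange_rhs => h.
  rewrite /Lam; apply/eqP; rewrite subr_eq0; apply/eqP.
  transitivity (th (t0 / D) * (th tau * th (D / wB) * \prod_(i in I :\ i0) th (w i / D))).
    by rewrite /fB; ring.
  have fB0 : fB t0 = 0 by rewrite /fB divff // (th1 thL) mulr0.
  rewrite h fB0 !(mulr0, mul0r) add0r.
  rewrite [\sum_(i in I) _](big_setD1 i0 i0I) /= mulrDr; congr (_ + _).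
    rewrite big_split /= /fB; set P := \prod_(i in I :\ i0) th _; set Q := \prod_(i in I :\ i0) _.
    by field; exact: t0i0.
  rewrite mulr_sumr; apply: eq_bigr => i; rewrite !inE => /andP[ii0 iI].
  rewrite [\prod_(l in I :\ i) _](big_setD1 i0) /=; last by rewrite !inE eq_sym ii0.
  rewrite setD1C /fB; set P := \prod_(l in I :\ i0) _; set Q := \prod_(l in _ :\ _) _.
  have := nz i0 i i0I iI; rewrite eq_sym ii0 => /(_ isT) h1.
  by field; rewrite h1 nz0.
have Lamlin : th (t0 / t i0) * th (t0 * t i0 / (w0 * w i0)) * Lam f = cA * Lam fA - cB * Lam fB.
  rewrite /Lam; move: fE; set kk := th _ * th _ => fE.
  set S1 := \sum_(i in I) _; set S2 := \sum_(i in I) _; set S3 := \sum_(i in I) _.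
  have S : kk * S1 = cA * S2 - cB * S3.
    rewrite !mulr_sumr -sumrB; apply: eq_bigr => i _.
    set P := \prod_(l in _) _; set Q := \prod_(l in _) _.
    transitivity (th (D * tau / t i) * (kk * f (t i)) * (th (t0 / D) / th (t0 / t i)) * P * Q); first by ring.
    by rewrite fE //; ring.
  rewrite !mulrBr !mulrDr S.
  set P := \prod_(l in _) _; set Q := \prod_(l in _) _; set Q' := \prod_(l in _) _.
  transitivity (th tau * (kk * f D) * P - (th (D * tau / t0) * (kk * f t0) * Q * Q' + (cA * S2 - cB * S3))); first by ring.
  by rewrite !fE //; ring.
apply/eqP; rewrite -subr_eq0 -LamE; apply/eqP.
apply: (mulfI (mulf_neq0 t0i0 good)).
by rewrite Lamlin LamA LamB !mulr0 subrr.
Qed.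

Lemma lagrange_single t w t0 w0 D tau (i0 : T) : 
  (forall i, t i != 0) -> (forall i, w i != 0) -> t0 != 0 -> w0 != 0 -> D != 0 ->
  th (t0 / t i0) != 0 -> tau * (w0 * w i0) = t0 * t i0 ->
  lagrange_lhs [set i0] w w0 D tau = lagrange_rhs [set i0] t w t0 w0 D tau.
Proof.
move=> t_n w_n t00 w00 D0 nz tauE.
have -> : tau = t0 * t i0 / (w0 * w i0) by rewrite -tauE mulfK // mulf_neq0.
rewrite /lagrange_lhs /lagrange_rhs !big_set1 finset.setDv big_set0 mulr1.
have nz' : th (t i0 / t0) != 0.
  by rewrite thVdiv // mulf_neq0 // oppr_eq0 mulf_neq0 ?invr_eq0.
apply: (mulfI nz).
transitivity (th (t0 / t i0) * th (t0 * t i0 / (w0 * w i0)) * (th (D / w0) * th (w i0 / D))).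
  by ring.
rewrite th_split // [th (t i0 / t0)]thVdiv //.
rewrite (thVdiv (w_n i0) t00) (thVdiv (w_n i0) (t_n i0)).
have -> : D / (w0 * w i0 / t i0) = D * (t0 * t i0 / (w0 * w i0)) / t0.
  by field; rewrite t00 t_n w00 w_n.
have -> : D / (w0 * w i0 / t0) = D * (t0 * t i0 / (w0 * w i0)) / t i0.
  by field; rewrite t00 t_n w00 w_n.
by field; rewrite ?oppr_eq0 ?nz ?t00 ?t_n.
Qed.

(** Induction on the number of nodes through lagrange_step, whose last hypothesis
    may fail for the pair (t i0, w i0). Then it holds for (t i1, w i0), since
    otherwise th (t i0 / t i1) would vanish by the law on the zero set; a
    permutation of the w i, which leaves both sides unchanged, brings w i0 in
    front of t i1. *)
Theorem lagrange (I : {set T}) t w t0 w0 D tau :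
  (forall i, t i != 0) -> (forall i, w i != 0) -> t0 != 0 -> w0 != 0 -> D != 0 ->
  (forall i, i \in I -> th (t0 / t i) != 0) ->
  (forall i j, i \in I -> j \in I -> i != j -> th (t i / t j) != 0) ->
  tau * (w0 * \prod_(i in I) w i) = t0 * \prod_(i in I) t i ->
  lagrange_lhs I w w0 D tau = lagrange_rhs I t w t0 w0 D tau.
Proof.
move=> t_n; elim: {I}_.+1 {-2}I (ltnSn #|I|) w t0 w0 => // m IH I cI w t0 w0 w_n t00 w00 D0 nz0 nz tauE.
have [I0|[i0 i0I]] := set_0Vmem I.
  rewrite I0 !big_set0 !mulr1 in tauE.
  rewrite /lagrange_lhs /lagrange_rhs I0 !big_set0 addr0 !mulr1 mulrC -tauE.
  have tau0 : tau != 0 by apply: contra_neq t00 => tau0; rewrite -tauE tau0 mul0r.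
  by congr (th _ * th _); field; rewrite ?w00 ?tau0.
have [I1|In1] := eqVneq I [set i0].
  rewrite I1 !big_set1 in tauE; rewrite I1.
  by apply: lagrange_single => //; apply: nz0.
have [i1 i1I i10] : exists2 i1, i1 \in I & i1 != i0.
  have [i1 i1I|h] := pickP (fun i => (i \in I) && (i != i0)).
    by exists i1; case/andP: i1I.
  case/eqP: In1; apply/setP => i; rewrite inE; apply/idP/eqP => [iI|-> //].
  by apply/eqP; have := h i; rewrite iI /= => /negbFE.
have step (v : T -> K) i : (forall i, v i != 0) -> i \in I -> \prod_(i in I) v i = \prod_(i in I) w i ->
   th (t0 * t i / (w0 * v i)) != 0 -> lagrange_lhs I v w0 D tau = lagrange_rhs I t v t0 w0 D tau.
  move=> v_n iI pv good.
  have cI' : (#|I :\ i| < m)%N by move: cI; rewrite (cardsD1 i) iI.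
  have tauE' : tau * (w0 * v i * \prod_(j in I :\ i) v j) = t0 * t i * \prod_(j in I :\ i) t j.
    by rewrite -mulrA -(big_setD1 _ iI) -mulrA -(big_setD1 _ iI) pv.
  apply: (lagrange_step iI) good => // w0' w0'E.
    have w0'0 : w0' != 0.
      apply: contra_eq_neq w0'E => ->; rewrite mul0r eq_sym mulf_neq0 //.
    apply: IH => // [j|j l|].
    - by rewrite !inE => /andP[_]; exact: nz0.
    - by rewrite !inE => /andP[_ jI] /andP[_ lI]; exact: nz.
    by apply: (mulIf (t_n i)); transitivity (t0 * t i * \prod_(j in I :\ i) t j); [rewrite -tauE' -w0'E|]; ring.
  have w0'0 : w0' != 0.
    apply: contra_eq_neq w0'E => ->; rewrite mul0r eq_sym mulf_neq0 //.
  apply: IH => // [j|j l|].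
  - by rewrite !inE => /andP[ji jI]; apply: nz; rewrite // eq_sym.
  - by rewrite !inE => /andP[_ jI] /andP[_ lI]; exact: nz.
  by apply: (mulIf t00); transitivity (t0 * t i * \prod_(j in I :\ i) t j); [rewrite -tauE' -w0'E|]; ring.
have [bad|good] := eqVneq (th (t0 * t i0 / (w0 * w i0))) 0; last exact: (step w i0).
(* The pair (t i0, w i0) is degenerate: exchange w i0 with w i1. *)
pose v := w \o tperm i0 i1.
have reindex (F : T -> K) : \prod_(i in I) F (tperm i0 i1 i) = \prod_(i in I) F i.
  rewrite [RHS](reindex_inj (@perm_inj _ (tperm i0 i1))) /=; apply: eq_bigl => i.
  by case: tpermP => [->|->|//]; rewrite i0I i1I.
have : lagrange_lhs I v w0 D tau = lagrange_rhs I t v t0 w0 D tau.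
  apply: (step v i1) => //; [by move=> i; exact: w_n|exact: (reindex w)|].
  rewrite /v /= tpermR; apply: contra_neq (nz i0 i1 i0I i1I _) => [h|]; last by rewrite eq_sym.
  have -> : t i0 / t i1 = (t0 * t i0 / (w0 * w i0)) / (t0 * t i1 / (w0 * w i0)).
    by field; rewrite t00 t_n w00 w_n.
  by apply: (th_div0 thL) => //; rewrite !mulf_neq0 ?invr_eq0 ?mulf_neq0.
rewrite /lagrange_lhs /lagrange_rhs /v /=.
rewrite (reindex (fun i => th (w i / D))) !big_split /= (reindex (fun i => th (w i / t0))) => ->.
by congr (_ + _); apply: eq_bigr => i _; rewrite (reindex (fun l => th (w l / t i))).
Qed.

End Lagrange.

(** * Multi-indices *)

Section MultiIndex.
Variable n : nat.
Implicit Types (j k N : mindex n) (r s : 'I_n).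

Definition mle j k := [forall r, j r <= k r]%N.
Definition up j r : mindex n := [ffun s => (j s + (s == r))%N].
Definition down j r : mindex n := [ffun s => (j s - (s == r))%N].

Lemma mleP j k : reflect (forall r, (j r <= k r)%N) (mle j k).
Proof. exact: forallP. Qed.

Lemma upE j r s : up j r s = (j s + (s == r))%N. Proof. by rewrite ffunE. Qed.
Lemma downE j r s : down j r s = (j s - (s == r))%N. Proof. by rewrite ffunE. Qed.

Lemma mabs_up j r : mabs (up j r) = (mabs j).+1.
Proof.
rewrite /mabs (eq_bigr (fun s => j s + (s == r))%N) => [|s _]; last exact: upE.
rewrite big_split /= -[RHS]addn1; congr (_ + _)%N.
by rewrite (bigD1 r) //= eqxx big1 ?addn0 // => s /negPf ->.
Qed.

Lemma mabs_down j r : (0 < j r)%N -> (mabs (down j r)).+1 = mabs j.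
Proof.
move=> jr; rewrite -(mabs_up _ r); congr mabs; apply/ffunP => s.
by rewrite upE downE subnK //; case: eqP => [->|].
Qed.

Lemma leq_mabs j k : mle j k -> (mabs j <= mabs k)%N.
Proof. by move/mleP => jk; apply: leq_sum. Qed.

Lemma mle_mabs_eq j k : mle j k -> mabs j = mabs k -> j = k.
Proof.
move=> /mleP jk e; apply/ffunP => r; apply/eqP; rewrite eqn_leq jk /= leqNgt.
apply/negP => lt; suff : (mabs j < mabs k)%N by rewrite e ltnn.
by rewrite /mabs (bigD1 r) //= [X in (_ < X)%N](bigD1 r) //= -addSn leq_add // leq_sum.
Qed.

Lemma mle_up j k r : mle (up j r) k = mle j k && (j r < k r)%N.
Proof.
apply/mleP/andP => [h|[/mleP h hr] s]; last first.
  by rewrite upE; case: eqP => [->|_]; rewrite ?addn1 ?addn0.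
split; last by have := h r; rewrite upE eqxx addn1.
by apply/mleP => s; apply: leq_trans (h s); rewrite upE leq_addr.
Qed.

Lemma mle_down k N r : (0 < N r)%N -> mle k (down N r) = mle k N && (k r < N r)%N.
Proof.
move=> Nr; apply/mleP/andP => [h|[/mleP h hr] s]; last first.
  by rewrite downE; case: eqP => [->|_]; rewrite ?subn0 // leq_subRL // add1n.
split; last by have := h r; rewrite downE eqxx; lia.
by apply/mleP => s; apply: leq_trans (h s) _; rewrite downE leq_subr.
Qed.

Lemma mcross_up j r : (mcross (up j r) + j r = mcross j + mabs j)%N.
Proof.
rewrite /mcross.
transitivity (\sum_(s < n) \sum_(u < n | s < u) (j s * j u + (s == r) * j u + j s * (u == r)) + j r)%N.
  congr (_ + _)%N; apply: eq_bigr => s _; apply: eq_bigr => u su; rewrite !upE.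
  have : ((s == r) && (u == r) = false) by apply/negP => /andP[/eqP a /eqP b]; move: su; rewrite a b ltnn.
  by case: (s == r); case: (u == r) => //= _; lia.
transitivity (mcross j + (\sum_(u < n | r < u) j u + \sum_(s < n | s < r) j s) + j r)%N.
  congr (_ + _)%N.
  rewrite (eq_bigr (fun s => (\sum_(u < n | s < u) j s * j u)
      + ((\sum_(u < n | s < u) (s == r) * j u)
      + (\sum_(u < n | s < u) j s * (u == r))))%N); last first.
    by move=> s _; rewrite !big_split /= addnA.
  rewrite !big_split /=; congr (_ + (_ + _))%N.
    rewrite (bigD1 r) //= [X in (_ + X)%N]big1 => [|s /negPf sr]; last first.
      by rewrite big1 // => u _; rewrite sr.
    by rewrite addn0; apply: eq_bigr => u _; rewrite eqxx mul1n.
  rewrite [RHS]big_mkcond /=; apply: eq_bigr => s _.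
  rewrite big_mkcond (bigD1 r) //= eqxx muln1 big1 ?addn0 // => u /negPf ->.
  by rewrite muln0 if_same.
rewrite -addnA; congr (_ + _)%N; rewrite /mabs [RHS](bigD1 r) //= [RHS]addnC; congr (_ + _)%N.
rewrite [RHS](bigID (fun s : 'I_n => (r < s)%N)) /=; congr (_ + _)%N.
  by apply: eq_bigl => s; rewrite -val_eqE /=; case: ltngtP.
by apply: eq_bigl => s; rewrite -val_eqE /=; case: ltngtP.
Qed.

End MultiIndex.

(** * Factors of type A *)

Section Factors.
Variables (K : fieldType) (th : K -> K) (q : K) (n : nat) (x : 'I_n -> K).
Hypothesis thL : theta_law th.
Hypothesis q0 : q != 0.
Hypothesis x0 : forall r, x r != 0.
Implicit Types (j k N : mindex n) (r s : 'I_n) (z a b c : K).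

Definition qpoch z (m : nat) : K := \prod_(0 <= i < m) th (z * q ^+ i).

Lemma qpochS z m : qpoch z m.+1 = qpoch z m * th (z * q ^+ m).
Proof. by rewrite /qpoch big_nat_recr. Qed.

Lemma qpochSl z m : qpoch z m.+1 = th z * qpoch (z * q) m.
Proof.
rewrite /qpoch big_nat_recl // mulr1; congr (_ * _).
by apply: eq_bigr => i _; rewrite exprS mulrA.
Qed.

Definition xq j r : K := x r * q ^+ j r.

Lemma xq_neq0 j r : xq j r != 0.
Proof. by rewrite mulf_neq0 ?expf_neq0. Qed.

Lemma prod_xq j : \prod_s xq j s = q ^+ mabs j * \prod_s x s.
Proof. by rewrite big_split /= mulrC -(big_morph _ (exprD q) (expr0 q)). Qed.

Lemma xq_up j r s : xq (up j r) s = xq j s * (if s == r then q else 1).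
Proof. by rewrite /xq upE exprD mulrA; case: eqP => _; rewrite ?expr1 ?expr0. Qed.

Definition dA k j : K := \prod_r \prod_s qpoch (q * xq j r / xq j s) (k r - j r).

(** Extended by zero outside j <= k, so that the sums may run over any set that
    contains the relevant k, and the recursions below hold at the boundary. *)
Definition iA k j : K := if mle j k then (dA k j)^-1 else 0.

Hypothesis nzx : forall j k r s, r != s -> th (xq j r / xq k s) != 0.
Hypothesis nzq : forall m : nat, th (q ^+ m.+1) != 0.

(** The part of the ratio of dA k j to dA k (up j r) that does not depend
    on k. *)
Definition up_ratio j r : K := \prod_(s | s != r) (th (q * xq j r / xq j s) / th (xq j s / xq j r)).

Lemma up_ratio_neq0 j r : up_ratio j r != 0.
Proof.
apply/prodf_neq0 => s sr; rewrite mulf_neq0 ?invr_eq0 ?nzx //.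
have -> : q * xq j r = xq (up j r) r by rewrite xq_up eqxx mulrC.
by rewrite nzx // eq_sym.
Qed.

Lemma dA_up k j r : mle j k -> (j r < k r)%N ->
  dA k j = dA k (up j r) * (up_ratio j r * \prod_s th (xq k s / xq j r)).
Proof.
move=> /mleP jk jr.
have [d dE] : exists d, (k r - j r = d.+1)%N by exists (k r - j r).-1; lia.
have dE' : (k r - up j r r = d)%N by rewrite upE eqxx; lia.
have yE s : xq k s = xq j s * q ^+ (k s - j s).
  by rewrite /xq -mulrA -exprD subnKC.
pose F (a s : 'I_n) := qpoch (q * xq j a / xq j s) (k a - j a).
pose F' (a s : 'I_n) := qpoch (q * xq (up j r) a / xq (up j r) s) (k a - up j r a).
have rowr s : s != r -> F r s = th (q * xq j r / xq j s) * F' r s.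
  move=> sr; rewrite /F /F' dE dE' qpochSl !xq_up eqxx (negPf sr) mulr1; congr (_ * qpoch _ _); ring.
have rr : F r r = F' r r * th (xq k r / xq j r).
  rewrite /F /F' dE dE' qpochS !mulfK ?xq_neq0 // yE dE exprS; congr (_ * th _).
  by field; exact: xq_neq0.
have colr (a : 'I_n) : a != r -> F a r = F' a r * th (xq k a / xq j r) / th (xq j a / xq j r).
  move=> ar; apply: (mulIf (nzx j j ar)); rewrite mulfVK ?nzx // mulrC.
  rewrite /F /F' upE (negPf ar) addn0 !xq_up eqxx (negPf ar) mulr1.
  have -> : q * xq j a / (xq j r * q) = xq j a / xq j r by field; rewrite q0 xq_neq0.
  have -> : q * xq j a / xq j r = xq j a / xq j r * q by ring.
  by rewrite -qpochSl qpochS yE; congr (_ * th _); ring.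
have other (a s : 'I_n) : a != r -> s != r -> F a s = F' a s.
  by move=> ar sr; rewrite /F /F' upE !xq_up (negPf ar) (negPf sr) addn0 !mulr1.
have -> : dA k j = \prod_a \prod_s F a s by [].
have -> : dA k (up j r) = \prod_a \prod_s F' a s by [].
rewrite (bigD1 r) //= [\prod_s F r s](bigD1 r) //= rr.
rewrite [\prod_(s | _) F r s](eq_bigr _ rowr) big_split /=.
have -> : \prod_(a | a != r) \prod_s F a s =
  \prod_(a | a != r) ((th (xq k a / xq j r) / th (xq j a / xq j r)) * \prod_s F' a s).
  apply: eq_bigr => a ar; rewrite (bigD1 r) //= [in RHS](bigD1 r) //= colr //.
  by rewrite (eq_bigr (F' a)) => [|s sr]; [ring|exact: other].
rewrite big_split /= [in RHS](bigD1 r) //= [\prod_s F' r s](bigD1 r) //= /up_ratio.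
rewrite [\prod_s th _](bigD1 r) //= !big_split /=; ring.
Qed.

Lemma iA_up k j r : mle j k ->
  iA k (up j r) = iA k j * (up_ratio j r * \prod_s th (xq k s / xq j r)).
Proof.
move=> jk; rewrite /iA mle_up jk /=; case: ltnP => [jr|kr]; last first.
  rewrite [\prod_s _](bigD1 r) //=.
  have -> : xq k r = xq j r.
    by rewrite /xq; congr (_ * _ ^+ _); apply/eqP; rewrite eqn_leq kr; move/mleP: jk => ->.
  by rewrite divff ?xq_neq0 // (th1 thL) mul0r !mulr0.
rewrite (dA_up jk jr) invfM mulfVK //.
rewrite mulf_neq0 ?up_ratio_neq0 //; apply/prodf_neq0 => s _.
have [->|sr] := eqVneq s r; last exact: nzx.
rewrite /xq; have [d ->] : exists d, (k r = j r + d.+1)%N by exists (k r - j r).-1; lia.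
by rewrite exprD mulrA mulrC mulKf ?xq_neq0 // nzq.
Qed.

Lemma dA_down N k r : mle k N -> (k r < N r)%N ->
  dA N k = dA (down N r) k * \prod_s th (xq N r / xq k s).
Proof.
move=> /mleP kN kr.
have [d dE] : exists d, (N r - k r = d.+1)%N by exists (N r - k r).-1; lia.
have dE' : (down N r r - k r = d)%N by rewrite downE eqxx; lia.
rewrite /dA (bigD1 r) //= [in RHS](bigD1 r) //= dE dE'.
rewrite (eq_bigr (fun s => qpoch (q * xq k r / xq k s) d * th (xq N r / xq k s))); last first.
  move=> s _; rewrite qpochS; congr (_ * th _).
  have -> : xq N r = xq k r * q ^+ d.+1 by rewrite /xq -mulrA -exprD -dE subnKC // ltnW.
  by rewrite exprS; ring.
rewrite big_split /= mulrAC; congr (_ * _ * _).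
by apply: eq_bigr => a ar; apply: eq_bigr => s _; rewrite downE (negPf ar) subn0.
Qed.

Lemma iA_down N k r : (0 < N r)%N -> mle k N ->
  iA (down N r) k = iA N k * \prod_s th (xq N r / xq k s).
Proof.
move=> Nr kN; rewrite /iA mle_down // kN /=; case: ltnP => [kr|kr]; last first.
  rewrite [\prod_s _](bigD1 r) //=.
  have -> : xq N r = xq k r.
    by rewrite /xq; congr (_ * _ ^+ _); apply/eqP; rewrite eqn_leq kr; move/mleP: kN => ->.
  by rewrite divff ?xq_neq0 // (th1 thL) mul0r !mulr0.
rewrite (dA_down kN kr) invfM mulfVK //.
apply/prodf_neq0 => s _; have [->|sr] := eqVneq s r; last by rewrite nzx // eq_sym.
rewrite /xq; have [d ->] : exists d, (N r = k r + d.+1)%N by exists (N r - k r).-1; lia.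
by rewrite exprD mulrA mulrC mulKf ?xq_neq0 // nzq.
Qed.

(** * Two partial fraction expansions *)

Variables (a c : K).
Hypothesis a0 : a != 0.
Hypothesis c0 : c != 0.
Hypothesis nza : forall s m, th (a * x s * q ^+ m.+1) != 0.
Hypothesis nzc : forall s m, th (c * x s * q ^+ m.+1) != 0.

Variables (N j : mindex n) (v : 'I_n).
Hypothesis jv : (j v < N v)%N.

(* One and the same recursion is to hold for the terms of the sum and for its
   value. It raises j in any direction, or lowers N in the direction v. *)
Let A := a * q ^+ (mabs j).+1.
Let Z := xq N v.
Let tau := c * q ^+ mabs j * Z.

(** The coefficient of the node xq j r, and then that of the node Z, in
    partial_fraction_source. They are free of k, which is why the expansion of
    each term of the sum gives a recursion for the sum. *)
Definition node_coef r : K := th (tau / (A * xq j r)) / th tau * (th (A * Z) / th (Z / xq j r))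
  * \prod_(l | l != r) (th (A * xq j l) / th (xq j l / xq j r)).

Definition node_coef0 : K := \prod_s th (A * xq j s) /
  (q ^+ mabs j * \prod_s th (a * q * x s) * \prod_s th (Z / xq j s) * th tau).

Let A0 : A != 0. Proof. by rewrite mulf_neq0 ?expf_neq0. Qed.
Let Z0 : Z != 0. Proof. exact: xq_neq0. Qed.

Let nzAx k s : th (A * xq k s) != 0.
Proof.
have -> : A * xq k s = a * x s * q ^+ (mabs j + k s).+1.
  by rewrite /A /xq -addSn exprD; ring.
exact: nza.
Qed.

Let nzZ s : th (Z / xq j s) != 0.
Proof.
have [->|sv] := eqVneq s v; last by rewrite nzx // eq_sym.
rewrite /Z /xq; have [d ->] : exists d, (N v = j v + d.+1)%N by exists (N v - j v).-1; lia.
by rewrite exprD mulrA mulrC mulKf ?xq_neq0 // nzq.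
Qed.

Let nztau : th tau != 0.
Proof.
rewrite /tau /Z /xq; have [d ->] : exists d, (N v = d.+1)%N by exists (N v).-1; lia.
have -> : c * q ^+ mabs j * (x v * q ^+ d.+1) = c * x v * q ^+ (mabs j + d).+1.
  by rewrite -addnS exprD; ring.
exact: nzc.
Qed.

(** Interpolation at the nodes xq j r and Z, evaluated at the inverse of A, of a
    function with zeros at the xq k s and at 1 / (c q ^ |k|). *)
Lemma partial_fraction_source k :
  th (c * q ^+ mabs k / A) * \prod_s th (A * xq k s) =
  \sum_r node_coef r * \prod_s th (xq k s / xq j r) * th (c * q ^+ mabs k * xq j r)
  + node_coef0 * q ^+ mabs k * \prod_s th (Z / xq k s) * th (c * q ^+ mabs k * Z)
    * th (tau / (A * Z)) * \prod_s th (a * q * x s).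
Proof.
set Y := q ^+ mabs k.
have Y0 : Y != 0 by exact: expf_neq0.
have w00 : (c * Y)^-1 != 0 by rewrite invr_eq0 mulf_neq0.
have E (F : 'I_n -> K) : \prod_(i in [set: 'I_n]) F i = \prod_i F i.
  by apply: eq_bigl => i; rewrite inE.
have := @lagrange K th thL _ [set: 'I_n] (xq j) (xq k) Z (c * Y)^-1 A^-1 tau
  (xq_neq0 j) (xq_neq0 k) Z0 w00 _ (fun i _ => nzZ i) _ _.
rewrite invr_eq0 => /(_ A0) h.
have {}h : lagrange_lhs th [set: 'I_n] (xq k) (c * Y)^-1 A^-1 tau =
  lagrange_rhs th [set: 'I_n] (xq j) (xq k) Z (c * Y)^-1 A^-1 tau.
  apply: h => [r s _ _ rs|]; first exact: nzx.
  by rewrite !E !prod_xq /tau -/Y; field; rewrite c0 Y0.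
apply: (mulfI nztau); move: h; rewrite /lagrange_lhs /lagrange_rhs !invrK.
rewrite !E => h.
transitivity (th tau * th (A^-1 * (c * Y)) * \prod_i th (xq k i * A)).
  rewrite mulrA [c * Y / A]mulrC; congr (_ * _).
  by apply: eq_bigr => s _; rewrite mulrC.
rewrite h [RHS]mulrDr addrC; congr (_ + _).
  rewrite mulr_sumr; apply: eq_big => [r|r _]; first by rewrite inE.
  rewrite E (_ : \prod_(l in [set: 'I_n] :\ r) _ = \prod_(l | l != r) (th (A * xq j l) / th (xq j l / xq j r))); last first.
    by apply: eq_big => [l|l _]; [rewrite !inE andbT|rewrite [_ * A]mulrC].
  rewrite /node_coef; have -> : A^-1 * tau / xq j r = tau / (A * xq j r).
    by field; rewrite A0 xq_neq0.
  have -> : Z * A = A * Z by ring.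
  have -> : xq j r * (c * Y) = c * Y * xq j r by ring.
  set P := \prod_l _; set Q := \prod_(l | _) _.
  by field; rewrite nztau nzZ.
rewrite /node_coef0.
have -> : \prod_i (th (xq k i / Z) * (th (xq j i * A) / th (xq j i / Z))) =
  \prod_i th (Z / xq k i) * \prod_i th (A * xq j i) / \prod_i th (Z / xq j i) * (q ^+ mabs k / q ^+ mabs j).
  have -> : q ^+ mabs k / q ^+ mabs j = \prod_i (xq k i / xq j i).
    rewrite big_split /= prodfV !prod_xq; field.
    by rewrite expf_neq0 // andbT; apply/prodf_neq0 => i _; exact: x0.
  rewrite -prodfV -!big_split /=; apply: eq_bigr => i _.
  rewrite (thVdiv thL (xq_neq0 k i) Z0) (thVdiv thL (xq_neq0 j i) Z0) [xq j i * A]mulrC.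
  by field; rewrite ?oppr_eq0 ?Z0 ?nzZ ?xq_neq0.
have -> : A^-1 * tau / Z = tau / (A * Z) by field; rewrite A0 Z0.
have -> : Z * (c * Y) = c * Y * Z by ring.
have P1 : \prod_i th (Z / xq j i) != 0 by apply/prodf_neq0 => i _.
have P2 : \prod_i th (a * q * x i) != 0.
  apply/prodf_neq0 => i _; have := nza i 0; rewrite expr1; congr (th _ != 0); ring.
by rewrite -/Y; field; rewrite P1 P2 nztau expf_neq0.
Qed.

Variables (b rho1 rho2 : K).
Hypothesis b0 : b != 0.
Hypothesis rho10 : rho1 != 0.
Hypothesis rho20 : rho2 != 0.
Hypothesis balance : b * (rho1 * rho2) = a * c * q.
Hypothesis jN : mle j N.

(* The directions outside I are those in which j has reached N; their factors
   cancel. *)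
Let I := [set s | (j s < N s)%N].
Let D := b * q ^+ mabs N / (a * q).
Let Om := tau / A.

Let D0 : D != 0. Proof. by rewrite !mulf_neq0 ?invr_eq0 ?mulf_neq0 ?expf_neq0. Qed.
Let tau0 : tau != 0. Proof. by rewrite !mulf_neq0 ?expf_neq0. Qed.
Let Om0 : Om != 0. Proof. by rewrite mulf_neq0 ?invr_eq0. Qed.
Let vI : v \in I. Proof. by rewrite inE. Qed.

Let off_I s : s \notin I -> xq N s = xq j s.
Proof.
rewrite inE -leqNgt => Ns; rewrite /xq; congr (_ * _ ^+ _).
by apply/eqP; rewrite eqn_leq Ns; move/mleP: jN => ->.
Qed.

Let prod_I : (\prod_(s in I) xq N s) * q ^+ mabs j = q ^+ mabs N * \prod_(s in I) xq j s.
Proof.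
have C0 : \prod_(s | s \notin I) xq j s != 0 by apply/prodf_neq0 => s _; exact: xq_neq0.
apply: (mulIf C0).
have EN : (\prod_(s in I) xq N s) * \prod_(s | s \notin I) xq j s = q ^+ mabs N * \prod_s x s.
  by rewrite -prod_xq [RHS](bigID (mem I)) /=; congr (_ * _); apply: eq_bigr => s /off_I.
have Ej : (\prod_(s in I) xq j s) * \prod_(s | s \notin I) xq j s = q ^+ mabs j * \prod_s x s.
  by rewrite -prod_xq [RHS](bigID (mem I)).
by rewrite mulrAC EN -[RHS]mulrA Ej; ring.
Qed.

Lemma node_coef_split r : r \in I ->
  node_coef r * (\prod_s th (xq N s / xq j r) / \prod_s th (A * xq N s)) =
  th (Om / xq j r) / th tau * \prod_(l in I :\ r) (th (A * xq j l) / th (xq j l / xq j r))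
  * (\prod_(l in I :\ v) th (xq N l / xq j r) / \prod_(l in I :\ v) th (A * xq N l)).
Proof.
move=> rI.
have splitr (F : 'I_n -> K) : \prod_(l | l != r) F l = (\prod_(l in I :\ r) F l) * \prod_(l | l \notin I) F l.
  rewrite (bigID (mem I)) /=; congr (_ * _); apply: eq_bigl => l; rewrite !inE //.
  by apply: andb_idl => h; apply: contraNneq h => ->; rewrite inE in rI.
have splitN (F : 'I_n -> K) : \prod_l F l = F v * (\prod_(l in I :\ v) F l) * \prod_(l | l \notin I) F l.
  by rewrite (bigID (mem I)) /= (big_setD1 v).
rewrite /node_coef splitr !splitN.
have -> : \prod_(l | l \notin I) th (xq N l / xq j r) = \prod_(l | l \notin I) th (xq j l / xq j r).
  by apply: eq_bigr => l lI; rewrite off_I.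
have -> : \prod_(l | l \notin I) th (A * xq N l) = \prod_(l | l \notin I) th (A * xq j l).
  by apply: eq_bigr => l lI; rewrite off_I.
have -> : tau / (A * xq j r) = Om / xq j r by rewrite /Om; field; rewrite A0 xq_neq0.
rewrite [X in _ * (_ * X) * _]big_split /= prodfV -/Z.
have h1 : \prod_(l | l \notin I) th (xq j l / xq j r) != 0.
  by apply/prodf_neq0 => l lI; apply: nzx; apply: contraNneq lI => ->.
have h2 : \prod_(l | l \notin I) th (A * xq j l) != 0 by apply/prodf_neq0 => l _.
have h3 : \prod_(l in I :\ v) th (A * xq N l) != 0 by apply/prodf_neq0 => l _.
by field; rewrite h1 h2 h3 nztau nzZ nzAx.
Qed.

Lemma prod_AX_split :
  \prod_s th (A * xq j s) / \prod_(s | s != v) th (A * xq N s) =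
  \prod_(s in I) th (A * xq j s) / \prod_(s in I :\ v) th (A * xq N s).
Proof.
rewrite (bigID (mem I)) /=.
have -> : \prod_(s | s != v) th (A * xq N s) = (\prod_(s in I :\ v) th (A * xq N s)) * \prod_(s | s \notin I) th (A * xq j s).
  rewrite (bigID (mem I)) /=; congr (_ * _); first by apply: eq_bigl => l; rewrite !inE.
  apply: eq_big => [l|l /andP[_ lI]]; last by rewrite off_I.
  by rewrite inE; apply: andb_idl => h; apply: contraNneq h => ->.
have h2 : \prod_(l | l \notin I) th (A * xq j l) != 0 by apply/prodf_neq0 => l _.
have h3 : \prod_(l in I :\ v) th (A * xq N l) != 0 by apply/prodf_neq0 => l _.
by field; rewrite h2 h3.
Qed.

(** Interpolation at the nodes xq j r, for r in I, and 1 / A, evaluated at D, of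
    a function whose zeros are 1 / rho1, Om and the xq N s with s in I and
    s <> v. The balancing condition puts the remaining argument at 1 / rho2,
    which restores the symmetry in rho1 and rho2. The node 1 / A gives the
    left-hand side, and the value at D the last summand. *)
Lemma partial_fraction_target :
  \prod_(s in I) th (D / xq j s) * (th (A / rho1) * th (A / rho2)) =
  \sum_(r in I) node_coef r * (th (rho1 * xq j r) * th (rho2 * xq j r)) * (A / (rho1 * rho2 * xq j r))
     * th (A * D) * \prod_(s in I :\ r) th (D / xq j s)
     * (\prod_s th (xq N s / xq j r) / \prod_s th (A * xq N s))
  + th (b * q ^+ mabs N / (c * Z)) * (th (c * q ^+ mabs N / rho1) * th (c * q ^+ mabs N / rho2))
    * \prod_(s in I :\ v) th (D / xq N s)
    * (\prod_s th (A * xq j s) / \prod_(s | s != v) th (A * xq N s)) / th tau.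
Proof.
rewrite prod_AX_split.
(* Trading the zero xq N v for Om produces, at D, the factor
   th (b q ^ |N| / (c Z)). *)
pose w s := if s == v then Om else xq N s.
have w_n s : w s != 0 by rewrite /w; case: (s == v); [exact: Om0|exact: (xq_neq0 N s)].
have wI (F : K -> K) : \prod_(l in I) F (w l) = F Om * \prod_(l in I :\ v) F (xq N l).
  rewrite (big_setD1 v) //= {1}/w eqxx; congr (_ * _).
  by apply: eq_bigr => l; rewrite !inE /w => /andP[/negPf ->].
have nzA1 s : th (A^-1 / xq j s) != 0.
  have AX0 : A * xq j s != 0 by rewrite mulf_neq0 ?xq_neq0.
  by rewrite -invfM (thV thL AX0) mulf_neq0 ?oppr_eq0 ?invr_eq0.
have Drho1 : D * rho1 = c * q ^+ mabs N / rho2.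
  rewrite /D; apply: (mulIf rho20); rewrite mulfVK //.
  transitivity (b * (rho1 * rho2) * q ^+ mabs N / (a * q)); first by ring.
  by rewrite balance; field; rewrite a0 q0.
have Drho2 : D * rho2 = c * q ^+ mabs N / rho1.
  rewrite /D; apply: (mulIf rho10); rewrite mulfVK //.
  transitivity (b * (rho1 * rho2) * q ^+ mabs N / (a * q)); first by ring.
  by rewrite balance; field; rewrite a0 q0.
have DOm : b * q ^+ mabs N / (c * Z) = D / Om.
  by rewrite /D /Om /tau /A exprS; field; rewrite a0 q0 c0 Z0 expf_neq0.
have := @lagrange K th thL _ I (xq j) w A^-1 rho1^-1 D (rho2 * D)^-1 (xq_neq0 j) w_n.
rewrite !invr_eq0 => /(_ A0 rho10 D0 (fun s _ => nzA1 s)) h.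
have {}h : lagrange_lhs th I w rho1^-1 D (rho2 * D)^-1 = lagrange_rhs th I (xq j) w A^-1 rho1^-1 D (rho2 * D)^-1.
  apply: h => [r s _ _ rs|]; first exact: nzx.
  rewrite (wI id) /=.
  have e : Om * \prod_(l in I :\ v) xq N l = c * q ^+ mabs N / A * \prod_(i in I) xq j i.
    transitivity (c / A * (\prod_(s in I) xq N s * q ^+ mabs j)).
      by rewrite (big_setD1 v vI) /= /Om /tau -/Z; ring.
    by rewrite prod_I; ring.
  have cN : c * q ^+ mabs N = D * rho1 * rho2 by rewrite Drho1 mulfVK.
  by rewrite e cN; field; rewrite rho10 rho20 D0 A0.
have wD : \prod_(l in I) th (w l / D) = th (Om / D) * \prod_(l in I :\ v) th (xq N l / D).
  exact: (wI (fun z => th (z / D))).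
have wA : \prod_(l in I) th (w l / A^-1) = th tau * \prod_(l in I :\ v) th (A * xq N l).
  rewrite (wI (fun z => th (z / A^-1))) invrK /Om mulfVK //; congr (_ * _).
  by apply: eq_bigr => l _; rewrite mulrC.
have wX r : \prod_(l in I) th (w l / xq j r) = th (Om / xq j r) * \prod_(l in I :\ v) th (xq N l / xq j r).
  exact: (wI (fun z => th (z / xq j r))).
(* The signs and ratios from thVdiv are collected apart; SE is their balance. *)
pose SX (J : {set 'I_n}) := \prod_(l in J) - (xq j l / D).
pose SZ := \prod_(l in I :\ v) - (xq N l / D).
have XD (J : {set 'I_n}) : \prod_(l in J) th (xq j l / D) = SX J * \prod_(l in J) th (D / xq j l).
  by rewrite -big_split; apply: eq_bigr => l _; rewrite thVdiv ?xq_neq0.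
have ZD : \prod_(l in I :\ v) th (xq N l / D) = SZ * \prod_(l in I :\ v) th (D / xq N l).
  by rewrite -big_split; apply: eq_bigr => l _; rewrite thVdiv ?xq_neq0.
have SX0 J : SX J != 0.
  by apply/prodf_neq0 => l _; rewrite oppr_eq0 mulf_neq0 ?xq_neq0 ?invr_eq0.
have SE : SZ * - (Z / D) * q ^+ mabs j = q ^+ mabs N * SX I.
  rewrite mulrC mulrA; transitivity (q ^+ mabs j * \prod_(l in I) - (xq N l / D)).
    by rewrite (big_setD1 v vI) /= /SZ -/Z; ring.
  have e (F : 'I_n -> K) : \prod_(l in I) - (F l / D) = (\prod_(l in I) F l) * \prod_(l in I) - D^-1.
    by rewrite -big_split; apply: eq_bigr => l _ /=; ring.
  by rewrite /SX !e mulrCA mulrA prod_I; ring.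
move: h; rewrite /lagrange_lhs /lagrange_rhs wD ZD big_split /= wA.
rewrite [X in _ * (_ * X) + _]big_split /= prodfV XD.
have -> : \prod_(i in I) th (xq j i / A^-1) = \prod_(s in I) th (A * xq j s).
  by apply: eq_bigr => l _; rewrite invrK mulrC.
have -> : D * (rho2 * D)^-1 = rho2^-1 by field; rewrite D0 rho20.
rewrite !invrK [rho2^-1 * A]mulrC.
have -> : A^-1 * rho1 = rho1 / A by rewrite mulrC.
rewrite (thVdiv thL rho10 A0) Drho1 (thVdiv thL Om0 D0) -DOm.
rewrite (thV thL (mulf_neq0 rho20 D0)) [rho2 * D]mulrC Drho2.
set PX := \prod_(l in I) th (D / xq j l); set PAX := \prod_(s in I) th (A * xq j s).
set PAZ := \prod_(l in I :\ v) th (A * xq N l); set PZD := \prod_(l in I :\ v) th (D / xq N l).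
set Sum := \sum_(i in I) _ => h.
have PAX0 : PAX != 0 by apply/prodf_neq0 => l _.
have PAZ0 : PAZ != 0 by apply/prodf_neq0 => l _.
pose F := PAX / PAZ / SX I * (- (A / rho1)).
have SumE : th tau * \sum_(r in I) node_coef r * (th (rho1 * xq j r) * th (rho2 * xq j r)) * (A / (rho1 * rho2 * xq j r))
     * th (A * D) * \prod_(s in I :\ r) th (D / xq j s)
     * (\prod_s th (xq N s / xq j r) / \prod_s th (A * xq N s)) = - F * Sum.
  rewrite !mulr_sumr; apply: eq_bigr => r rI.
  have Xr0 := xq_neq0 j r.
  have -> : rho2^-1 / xq j r = (rho2 * xq j r)^-1 by exact: esym (invfM _ _).
  have -> : A^-1 / xq j r = (A * xq j r)^-1 by exact: esym (invfM _ _).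
  have -> : A^-1 / D = (A * D)^-1 by exact: esym (invfM _ _).
  rewrite (thV thL (mulf_neq0 rho20 Xr0)) (thV thL (mulf_neq0 A0 Xr0)) (thV thL (mulf_neq0 A0 D0)).
  rewrite wX [X in _ = - F * (_ * X)]big_split /= prodfV XD.
  have SXr : SX I = - (xq j r / D) * SX (I :\ r) by exact: big_setD1.
  have PAXr : PAX = th (A * xq j r) * \prod_(l in I :\ r) th (A * xq j l) by exact: big_setD1.
  transitivity ((th (rho1 * xq j r) * th (rho2 * xq j r)) * (A / (rho1 * rho2 * xq j r)) * th (A * D)
    * \prod_(s in I :\ r) th (D / xq j s) * th tau
    * (node_coef r * (\prod_s th (xq N s / xq j r) / \prod_s th (A * xq N s)))); first by ring.
  have gs := node_coef_split rI; rewrite [X in _ = _ * X * _]big_split /= prodfV in gs.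
  rewrite gs -/PAZ /F SXr PAXr.
  have h1 := SX0 (I :\ r).
  have h2 : \prod_(l in I :\ r) th (xq j l / xq j r) != 0.
    by apply/prodf_neq0 => l; rewrite !inE => /andP[lr _]; exact: nzx.
  have h3 := nzAx j r.
  set P1 := \prod_(s in I :\ r) th (D / xq j s). set P2 := \prod_(l in I :\ r) th (A * xq j l).
  set P3 := \prod_(l in I :\ v) th (xq N l / xq j r).
  rewrite [xq j r * rho1]mulrC.
  by field; rewrite ?oppr_eq0 ?h1 ?h2 ?h3 ?nztau ?PAZ0 ?Xr0 ?rho10 ?rho20 ?A0 ?D0 ?nzAx ?oner_neq0.
apply: (mulfI nztau); rewrite [RHS]mulrDr SumE.
have -> : th tau * (PX * (th (A / rho1) * th (A / rho2))) =
   F * (th (A / rho2) * (- (rho1 / A) * th (A / rho1)) * (th tau * PAZ * (SX I * PX / PAX))).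
  by rewrite /F; field; rewrite PAX0 PAZ0 SX0 A0 rho10.
have -> : th (A / rho2) * (- (rho1 / A) * th (A / rho1)) * (th tau * PAZ * (SX I * PX / PAX)) =
  - (c * q ^+ mabs N / rho1)^-1 * th (c * q ^+ mabs N / rho1) * th (c * q ^+ mabs N / rho2) *
     (- (Om / D) * th (b * q ^+ mabs N / (c * Z)) * (SZ * PZD)) - Sum.
  by apply/eqP; rewrite eq_sym subr_eq eq_sym -h.
rewrite mulrBr addrC; congr (_ + _); first by rewrite mulNr.
have -> : SZ = - (D / Z) * (q ^+ mabs N / q ^+ mabs j) * SX I.
  apply: (mulIf (_ : - (Z / D) * q ^+ mabs j != 0)).
    by rewrite mulf_neq0 ?oppr_eq0 ?mulf_neq0 ?invr_eq0 ?expf_neq0.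
  by rewrite mulrA SE; field; rewrite Z0 D0 expf_neq0.
set t1 := th (c * _ / rho1); set t2 := th (c * _ / rho2); set t3 := th (b * _ / _).
have tt0 := nztau; set tt := th tau in tt0 *.
have qN0 : q ^+ mabs N != 0 by exact: expf_neq0.
have qj0 : q ^+ mabs j != 0 by exact: expf_neq0.
rewrite /F /Om /tau.
by field; rewrite ?PAX0 ?PAZ0 ?SX0 ?A0 ?D0 ?Z0 ?rho10 ?c0 ?qN0 ?qj0 ?tt0.
Qed.

(** * The Jackson sum and its recursion *)

(** The two Bailey matrices with xq N r in place of x r and natural numbers as
    indices, extended by zero off the triangle. *)
Definition B2m a' b' N' j' : K :=
  qpoch b' (mabs N' + mabs j')
  * (\prod_r qpoch (b' * q ^+ mabs N' / (a' * xq N' r)) (N' r - j' r))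
  * iA N' j' / \prod_r qpoch (a' * x r * q) (N' r + mabs j').

Definition B1m a' c' k' j' : K :=
  qpoch (c' / a') (mabs k' - mabs j') * iA k' j'
  * (\prod_r qpoch (c' * x r) (j' r + mabs k')) / \prod_r qpoch (a' * x r * q) (k' r + mabs j').

Definition rho_factor a' (i : nat) : K :=
  th (a' * q ^+ i.+1 / rho1) * th (a' * q ^+ i.+1 / rho2).

Definition x_factor k' : K := \prod_r (qpoch (rho1 * x r) (k' r) * qpoch (rho2 * x r) (k' r)).

Definition wt a' k' : K :=
  (a' * q / (rho1 * rho2)) ^+ mabs k' * (\prod_r x r ^- k' r) * q ^+ mcross k'.

(** The very-well-poised factor of the A_n series. *)
Definition vwp k' : K := \prod_r (th (c * x r * q ^+ (k' r + mabs k')) / th (c * x r)).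

(** Summed over k, a weighted product of the matrices B2m c b and B1m a c. The
    product over i is a quotient of shifted factorials, written without a
    denominator. *)
Definition jackson_term a' b' N' k' j' : K :=
  B2m c b' N' k' * (x_factor k' * \prod_(mabs k' <= i < mabs N') rho_factor c i)
  * vwp k' * wt a' k' * B1m a' c k' j'.

Definition jackson_value a' b' N' j' : K :=
  B2m a' b' N' j' * (x_factor j' * \prod_(mabs j' <= i < mabs N') rho_factor a' i) * wt a' j'.

Definition coef_up r : K := node_coef r / up_ratio j r.
Definition coef_down : K :=
  th b * th (b * q ^+ mabs N / (c * Z)) * node_coef0 * rho_factor c (mabs N).-1.

Let Nv : (0 < N v)%N. Proof. exact: leq_ltn_trans jv. Qed.

Lemma wt_q k : wt (a * q) k = q ^+ mabs k * wt a k.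
Proof.
rewrite /wt (_ : a * q * q / (rho1 * rho2) = q * (a * q / (rho1 * rho2))); last by ring.
by rewrite exprMn; ring.
Qed.

Lemma wt_up r : wt a (up j r) = wt a j * (A / (rho1 * rho2 * xq j r)).
Proof.
rewrite /wt mabs_up.
have -> : \prod_s x s ^- up j r s = (\prod_s x s ^- j s) / x r.
  rewrite (bigD1 r) //= [in RHS](bigD1 r) //= upE eqxx addn1 exprSr invfM.
  rewrite (eq_bigr (fun s => x s ^- j s)) => [|s /negPf sr]; last by rewrite upE sr addn0.
  ring.
have -> : q ^+ mcross (up j r) = q ^+ mcross j * q ^+ mabs j / q ^+ j r.
  by rewrite -exprD -(mcross_up j r) exprD mulfK // expf_neq0.
rewrite exprS /A exprS /xq; field.
by rewrite !expf_neq0 // x0 rho10 rho20.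
Qed.

Let qpoch_a_neq0 s m : qpoch (a * x s * q) m != 0.
Proof.
elim: m => [|m IH]; first by rewrite /qpoch big_geq ?oner_neq0.
rewrite qpochS mulf_neq0 //; have := nza s m; rewrite exprS; congr (th _ != 0); ring.
Qed.

Lemma B1m_up k r : mle j k ->
  B1m a c k (up j r) * \prod_s th (A * xq k s) =
  qpoch (c / a) (mabs k - (mabs j).+1) * iA k j
   * (\prod_s qpoch (c * x s) (j s + mabs k)) / \prod_s qpoch (a * x s * q) (k s + mabs j)
   * (up_ratio j r * \prod_s th (xq k s / xq j r) * th (c * q ^+ mabs k * xq j r)).
Proof.
move=> jk; rewrite /B1m mabs_up iA_up //.
have -> : \prod_s qpoch (a * x s * q) (k s + (mabs j).+1) =
   \prod_s qpoch (a * x s * q) (k s + mabs j) * \prod_s th (A * xq k s).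
  rewrite -big_split; apply: eq_bigr => s _; rewrite addnS qpochS /=; congr (_ * th _).
  by rewrite /A /xq exprS exprD; ring.
have -> : \prod_s qpoch (c * x s) (up j r s + mabs k) =
   (\prod_s qpoch (c * x s) (j s + mabs k)) * th (c * q ^+ mabs k * xq j r).
  rewrite (bigD1 r) //= [in RHS](bigD1 r) //= upE eqxx addn1 addSn qpochS.
  rewrite (eq_bigr (fun s => qpoch (c * x s) (j s + mabs k))) => [|s /negPf sr]; last by rewrite upE sr addn0.
  have -> : c * x r * q ^+ (j r + mabs k) = c * q ^+ mabs k * xq j r by rewrite /xq exprD; ring.
  ring.
have h : \prod_s th (A * xq k s) != 0 by apply/prodf_neq0 => s _.
have h' : \prod_s qpoch (a * x s * q) (k s + mabs j) != 0 by apply/prodf_neq0 => s _.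
by field; rewrite h h'.
Qed.

Lemma B1m_q k :
  B1m (a * q) c k j * \prod_s th (A * xq k s) =
  qpoch (c / (a * q)) (mabs k - mabs j) * iA k j
   * (\prod_s qpoch (c * x s) (j s + mabs k)) / \prod_s qpoch (a * x s * q) (k s + mabs j)
   * \prod_s th (a * q * x s).
Proof.
rewrite /B1m.
have h' : \prod_s qpoch (a * x s * q) (k s + mabs j) != 0 by apply/prodf_neq0 => s _.
have e : \prod_s qpoch (a * q * x s * q) (k s + mabs j) * \prod_s th (a * q * x s) =
   \prod_s qpoch (a * x s * q) (k s + mabs j) * \prod_s th (A * xq k s).
  rewrite -!big_split; apply: eq_bigr => s _ /=.
  have -> : a * q * x s = a * x s * q by ring.
  rewrite mulrC -qpochSl qpochS; congr (_ * th _).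
  by rewrite /A /xq exprS exprD; ring.
have h'' : \prod_s qpoch (a * q * x s * q) (k s + mabs j) != 0.
  have : \prod_s qpoch (a * x s * q) (k s + mabs j) * \prod_s th (A * xq k s) != 0.
    by rewrite mulf_neq0 //; apply/prodf_neq0 => s _.
  by rewrite -e mulf_eq0 => /norP[].
apply: (mulfI h''); apply: (mulfI h').
set P1 := \prod_s qpoch (a * q * x s * q) _ in e h'' *.
set P2 := \prod_s qpoch (a * x s * q) _ in e h' *.
transitivity (qpoch (c / (a * q)) (mabs k - mabs j) * iA k j * (\prod_s qpoch (c * x s) (j s + mabs k)) *
  (P2 * \prod_s th (A * xq k s))); first by field.
by rewrite -e; field.
Qed.

Lemma B2m_down_source k : mle k N ->
  (th b * th (b * q ^+ mabs N / (c * Z))) * B2m c (b * q) (down N v) k =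
  B2m c b N k * \prod_s th (Z / xq k s) * th (c * q ^+ mabs k * Z).
Proof.
move=> kN; rewrite /B2m iA_down //.
have [kv|Nk] := ltnP (k v) (N v); last first.
  have -> : \prod_s th (xq N v / xq k s) = 0.
    rewrite (bigD1 v) //= (_ : xq k v = xq N v) ?divff ?xq_neq0 ?(th1 thL) ?mul0r //.
    by rewrite /xq; congr (_ * _ ^+ _); apply/eqP; rewrite eqn_leq Nk; move/mleP: kN => ->.
  by rewrite !(mulr0, mul0r).
have mN := mabs_down Nv.
have -> : qpoch b (mabs N + mabs k) = th b * qpoch (b * q) (mabs (down N v) + mabs k).
  by rewrite -mN addSn qpochSl.
have qpoch_c_neq0 s m : qpoch (c * x s * q) m != 0.
  elim: m => [|m IH]; first by rewrite /qpoch big_geq ?oner_neq0.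
  rewrite qpochS mulf_neq0 //; have := nzc s m; rewrite exprS; congr (th _ != 0); ring.
have -> : \prod_r qpoch (b * q ^+ mabs N / (c * xq N r)) (N r - k r) =
   th (b * q ^+ mabs N / (c * Z)) *
   \prod_r qpoch (b * q * q ^+ mabs (down N v) / (c * xq (down N v) r)) (down N v r - k r).
  rewrite (bigD1 v) //= [in RHS](bigD1 v) //= [RHS]mulrA; congr (_ * _); last first.
    apply: eq_bigr => s /negPf sv; rewrite /xq downE sv subn0.
    by rewrite -mN exprS mulrA.
  have dE : (N v - k v = (N v - k v).-1.+1)%N by rewrite prednK // subn_gt0.
  rewrite {}dE downE eqxx subnAC subn1.
  rewrite qpochSl -/Z; congr (_ * qpoch _ _).
  have -> : Z = xq (down N v) v * q.
    by rewrite /Z /xq downE eqxx -mulrA -exprSr subn1 prednK.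
  by rewrite -mN exprS; field; rewrite c0 xq_neq0 q0.
have -> : \prod_r qpoch (c * x r * q) (N r + mabs k) =
   \prod_r qpoch (c * x r * q) (down N v r + mabs k) * th (c * q ^+ mabs k * Z).
  rewrite (bigD1 v) //= [in RHS](bigD1 v) //=.
  have NvE : (N v = (down N v v).+1)%N by rewrite downE eqxx subn1 prednK.
  rewrite {1}NvE addSn qpochS.
  have -> : c * x v * q * q ^+ (down N v v + mabs k) = c * q ^+ mabs k * Z.
    by rewrite /Z /xq NvE exprD exprS; ring.
  have -> : \prod_(i | i != v) qpoch (c * x i * q) (down N v i + mabs k) =
      \prod_(i | i != v) qpoch (c * x i * q) (N i + mabs k).
    by apply: eq_bigr => s /negPf sv; rewrite downE sv subn0.
  ring.
have h1 : \prod_r qpoch (c * x r * q) (down N v r + mabs k) != 0 by apply/prodf_neq0 => s _.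
have h2 : th (c * q ^+ mabs k * Z) != 0.
  rewrite /Z /xq -(prednK Nv).
  have := nzc v (mabs k + (N v).-1); rewrite -addnS exprD; congr (th _ != 0); ring.
rewrite -/Z; field; by rewrite h1 h2.
Qed.

(** Apart from common factors this is partial_fraction_source, term by term
    in k. *)
Lemma jackson_term_rec k :
  jackson_term a b N k j =
  \sum_r coef_up r * jackson_term a b N k (up j r) + coef_down * jackson_term (a * q) (b * q) (down N v) k j.
Proof.
rewrite /jackson_term.
have [kN|kN] := boolP (mle k N); last first.
  have z1 b' : B2m c b' N k = 0 by rewrite /B2m /iA (negPf kN) mulr0 mul0r.
  have z2 b' : B2m c b' (down N v) k = 0.
    by rewrite /B2m /iA mle_down // (negPf kN) mulr0 mul0r.
  by rewrite z1 z2 !mul0r mulr0 addr0 big1 // => r _; rewrite !mul0r mulr0.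
have [jk|jk] := boolP (mle j k); last first.
  have z1 a' : B1m a' c k j = 0 by rewrite /B1m /iA (negPf jk) mulr0 !mul0r.
  have z2 a' r : B1m a' c k (up j r) = 0.
    by rewrite /B1m /iA mle_up (negPf jk) mulr0 !mul0r.
  by rewrite !z1 !mulr0 addr0 big1 // => r _; rewrite z2 !mulr0.
have PA0 : \prod_s th (A * xq k s) != 0 by apply/prodf_neq0 => s _.
pose V0 := iA k j * (\prod_s qpoch (c * x s) (j s + mabs k)) / \prod_s qpoch (a * x s * q) (k s + mabs j).
have downE : coef_down * (B2m c (b * q) (down N v) k *
   (x_factor k * \prod_(mabs k <= i < mabs (down N v)) rho_factor c i)) =
   node_coef0 * (B2m c b N k * \prod_s th (Z / xq k s) * th (c * q ^+ mabs k * Z)) *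
   (x_factor k * \prod_(mabs k <= i < mabs N) rho_factor c i).
  have [kd|kd] := boolP (mle k (down N v)); last first.
    have z : B2m c (b * q) (down N v) k = 0 by rewrite /B2m /iA (negPf kd) mulr0 mul0r.
    by rewrite -B2m_down_source // z !(mul0r, mulr0).
  rewrite -B2m_down_source // /coef_down -[in RHS](mabs_down Nv) big_nat_recr ?leq_mabs //=.
  by rewrite -(mabs_down Nv) /=; ring.
rewrite wt_q.
set B := B2m c b N k in downE *; set B' := B2m c (b * q) (down N v) k in downE *.
set P := x_factor k * \prod_(mabs k <= i < mabs N) _ in downE *.
set P' := x_factor k * _ in downE *.
apply: (mulIf PA0).
transitivity (B * P * vwp k * wt a k * V0 *
  (qpoch (c / a) (mabs k - mabs j) * \prod_s th (A * xq k s))).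
  by rewrite /B1m /V0; ring.
transitivity (B * P * vwp k * wt a k * V0 *
  (\sum_r node_coef r * qpoch (c / a) (mabs k - (mabs j).+1) * \prod_s th (xq k s / xq j r) * th (c * q ^+ mabs k * xq j r)
  + node_coef0 * q ^+ mabs k * \prod_s th (Z / xq k s) * th (c * q ^+ mabs k * Z)
      * qpoch (c / (a * q)) (mabs k - mabs j) * \prod_s th (a * q * x s))); last first.
  rewrite mulrDr [RHS]mulrDl; congr (_ + _).
    rewrite mulr_sumr mulr_suml; apply: eq_bigr => r _.
    transitivity (coef_up r * (B * P * vwp k * wt a k) * (B1m a c k (up j r) * \prod_s th (A * xq k s))); last by ring.
    rewrite B1m_up // /coef_up /V0.
    set P1 := \prod_s th (xq k s / xq j r); set P2 := \prod_s qpoch (c * _) _; set P3 := \prod_s qpoch _ _.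
    have P30 : P3 != 0 by apply/prodf_neq0 => s _.
    have u0 := up_ratio_neq0 j r; by field; rewrite P30 u0.
  transitivity (coef_down * (B' * P') * vwp k * (q ^+ mabs k * wt a k) * (B1m (a * q) c k j * \prod_s th (A * xq k s))); last by ring.
  by rewrite downE B1m_q /V0; ring.
congr (_ * _).
have [m0|m0] := posnP (mabs k - mabs j).
  have kj : j = k.
    by apply: mle_mabs_eq => //; apply/eqP; rewrite eqn_leq leq_mabs //= -subn_eq0 m0.
  have qpoch0 z : qpoch z 0 = 1 by rewrite /qpoch big_geq.
  rewrite -kj subnn !qpoch0 mul1r [\sum_r _]big1 => [|r _]; last first.
    by rewrite (bigD1 r) //= divff ?xq_neq0 // (th1 thL) !(mul0r, mulr0).
  rewrite add0r /node_coef0 mulr1.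
  have h1 : \prod_s th (Z / xq j s) != 0 by apply/prodf_neq0 => s _.
  have h2 : \prod_s th (a * q * x s) != 0.
    by apply/prodf_neq0 => s _; have := nza s 0; rewrite expr1; congr (th _ != 0); ring.
  have -> : c * q ^+ mabs j * Z = tau by [].
  have h3 := nztau; have h4 : q ^+ mabs j != 0 by exact: expf_neq0.
  by field; rewrite h1 h2 h3 h4.
have dE : (mabs k - mabs j = (mabs k - (mabs j).+1).+1)%N by rewrite subnS prednK.
set d := (mabs k - (mabs j).+1)%N in dE *; rewrite dE qpochS qpochSl.
have -> : c / (a * q) * q = c / a by field; rewrite a0 q0.
have -> : c / a * q ^+ d = c * q ^+ mabs k / A.
  have -> : mabs k = (d + (mabs j).+1)%N by rewrite subnK // -subn_gt0.
  by rewrite /A exprD; field; rewrite a0 expf_neq0.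
have -> : c / (a * q) = tau / (A * Z).
  by rewrite /tau /A exprS; field; rewrite a0 q0 Z0 expf_neq0.
rewrite -mulrA partial_fraction_source mulrDr; congr (_ + _); last by ring.
by rewrite mulr_sumr; apply: eq_bigr => r _; ring.
Qed.

Let p1 := qpoch (b * q) (mabs (down N v) + mabs j).
Let VS := \prod_(s in I) qpoch (b * q ^+ mabs N / (a * xq N s)) (N s - j s).-1.
Let dd := \prod_s qpoch (a * x s * q) (N s + mabs j).

Let Nj0 s : s \notin I -> (N s - j s = 0)%N.
Proof. by rewrite inE -leqNgt => h; apply/eqP; rewrite subn_eq0. Qed.

Let NjS s : s \in I -> (N s - j s = (N s - j s).-1.+1)%N.
Proof. by rewrite inE => h; rewrite prednK // subn_gt0. Qed.

Let qpoch0 z : qpoch z 0 = 1. Proof. by rewrite /qpoch big_geq. Qed.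

Let prod_onI (F : 'I_n -> K) : (forall s, s \notin I -> F s = 1) -> \prod_s F s = \prod_(s in I) F s.
Proof. by move=> h; rewrite (bigID (mem I)) /= [X in _ * X]big1 ?mulr1. Qed.

Let DX s : s \in I -> b * q ^+ mabs N / (a * xq N s) * q ^+ (N s - j s).-1 = D / xq j s.
Proof.
move=> sI; have jsN : (j s < N s)%N by move: sI; rewrite inE.
have -> : xq N s = xq j s * q ^+ (N s - j s).-1 * q.
  by rewrite /xq -!mulrA -exprSr -NjS // -exprD subnKC // ltnW.
by rewrite /D; field; rewrite a0 q0 xq_neq0 expf_neq0.
Qed.

Let qpoch_b : qpoch b (mabs N + mabs j) = th b * p1.
Proof. by rewrite /p1 -(mabs_down Nv) addSn qpochSl. Qed.

Lemma B2m_split :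
  B2m a b N j = th b * p1 * (VS * \prod_(s in I) th (D / xq j s)) * iA N j / dd.
Proof.
rewrite /B2m qpoch_b /dd; congr (_ * _ * _ * _).
rewrite prod_onI => [|s sI]; last by rewrite Nj0 // qpoch0.
rewrite /VS -big_split; apply: eq_bigr => s sI /=.
by rewrite (NjS sI) qpochS DX.
Qed.

Lemma B2m_up_target r : r \in I ->
  B2m a b N (up j r) * \prod_s th (A * xq N s) =
  th b * p1 * th (A * D) * (VS * \prod_(s in I :\ r) th (D / xq j s))
   * (iA N j * (up_ratio j r * \prod_s th (xq N s / xq j r))) / dd.
Proof.
move=> rI; rewrite /B2m mabs_up addnS qpochS qpoch_b iA_up //.
have -> : b * q ^+ (mabs N + mabs j) = A * D.
  by rewrite /A /D exprD exprS; field; rewrite a0 q0.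
have -> : \prod_s qpoch (a * x s * q) (N s + (mabs j).+1) = dd * \prod_s th (A * xq N s).
  rewrite -big_split; apply: eq_bigr => s _; rewrite addnS qpochS /=; congr (_ * th _).
  by rewrite /A /xq exprS exprD; ring.
have -> : \prod_s qpoch (b * q ^+ mabs N / (a * xq N s)) (N s - up j r s) =
   VS * \prod_(s in I :\ r) th (D / xq j s).
  rewrite prod_onI => [|s sI]; last first.
    rewrite upE; case: eqP => [sr|_]; first by rewrite sr rI in sI.
    by rewrite addn0 Nj0 // qpoch0.
  rewrite /VS (big_setD1 r rI) [in RHS](big_setD1 r rI) /= -[RHS]mulrA -[X in _ = _ * X]big_split /=.
  congr (_ * _); first by rewrite upE eqxx addn1 subnS.
  apply: eq_bigr => s; rewrite !inE upE => /andP[/negPf -> sI].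
  by rewrite addn0 NjS ?inE // qpochS DX ?inE.
have h : \prod_s th (A * xq N s) != 0 by apply/prodf_neq0 => s _.
have h' : dd != 0 by apply/prodf_neq0 => s _.
by field; rewrite h h'.
Qed.

Lemma B2m_down_target :
  B2m (a * q) (b * q) (down N v) j * \prod_(s | s != v) th (A * xq N s) =
  p1 * (VS * \prod_(s in I :\ v) th (D / xq N s))
   * (iA N j * \prod_s th (Z / xq j s)) * \prod_s th (a * q * x s) / dd.
Proof.
rewrite /B2m iA_down // -/p1 -/Z.
have -> : \prod_r qpoch (b * q * q ^+ mabs (down N v) / (a * q * xq (down N v) r)) (down N v r - j r) =
   VS * \prod_(s in I :\ v) th (D / xq N s).
  have e : b * q * q ^+ mabs (down N v) = b * q ^+ mabs N.
    by rewrite -(mabs_down Nv) exprS mulrA.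
  rewrite e prod_onI => [|s sI]; last first.
    by rewrite downE -subnDA addnC subnDA Nj0 // qpoch0.
  rewrite /VS (big_setD1 v vI) [in RHS](big_setD1 v vI) /= -[RHS]mulrA -[X in _ = _ * X]big_split /=.
  congr (_ * _).
    rewrite downE eqxx subnAC subn1; congr (qpoch _ _).
    have -> : xq N v = xq (down N v) v * q.
      by rewrite /xq downE eqxx -mulrA -exprSr subn1 prednK.
    by field; rewrite a0 q0 xq_neq0.
  apply: eq_bigr => s; rewrite in_setD1 => /andP[/negPf sv sI].
  have -> : xq (down N v) s = xq N s by rewrite /xq downE sv subn0.
  rewrite downE sv subn0 (NjS sI) qpochSl mulrC; congr (qpoch _ _ * th _).
    by field; rewrite a0 q0 xq_neq0.
  by rewrite /D; field; rewrite a0 q0 xq_neq0.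
have e : \prod_s qpoch (a * q * x s * q) (down N v s + mabs j) * \prod_s th (a * q * x s) =
   dd * \prod_(s | s != v) th (A * xq N s).
  rewrite /dd [\prod_s qpoch (a * q * x s * q) _](bigD1 v) //= [\prod_s th (a * q * x s)](bigD1 v) //=.
  rewrite [\prod_s qpoch (a * x s * q) _](bigD1 v) //= mulrACA -[RHS]mulrA -!big_split /=.
  have ax s : a * q * x s = a * x s * q by ring.
  congr (_ * _).
    by rewrite ax mulrC -qpochSl downE eqxx subn1 -addSn prednK.
  apply: eq_bigr => s /negPf sv; rewrite ax mulrC -qpochSl qpochS downE sv subn0; congr (_ * th _).
  by rewrite /A /xq exprS exprD; ring.
have h' : dd != 0 by apply/prodf_neq0 => s _.
have h : \prod_(s | s != v) th (A * xq N s) != 0 by apply/prodf_neq0 => s _.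
set P1 := \prod_s qpoch (a * q * x s * q) _ in e *.
have hP1 : P1 != 0.
  have : P1 * \prod_s th (a * q * x s) != 0 by rewrite e mulf_neq0.
  by rewrite mulf_eq0 => /norP[].
apply: (mulIf hP1); apply: (mulIf h').
set V1 := VS * _.
transitivity (p1 * V1 * (iA N j * \prod_s th (Z / xq j s)) * (dd * \prod_(s | s != v) th (A * xq N s))).
  by field.
by rewrite -e; field.
Qed.

(** The same recursion with the same coefficients, from
    partial_fraction_target. *)
Lemma jackson_value_rec :
  jackson_value a b N j =
  \sum_r coef_up r * jackson_value a b N (up j r) + coef_down * jackson_value (a * q) (b * q) (down N v) j.
Proof.
have jN' : (mabs j < mabs N)%N.
  rewrite ltn_neqAle leq_mabs // andbT; apply/eqP => e.
  by have := jv; rewrite (mle_mabs_eq jN e) ltnn.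
pose PG := \prod_((mabs j).+1 <= i < mabs N) rho_factor a i.
pose M := th b * p1 * VS * iA N j / dd * x_factor j * PG * wt a j.
have LE : jackson_value a b N j = M * (\prod_(s in I) th (D / xq j s) * (th (A / rho1) * th (A / rho2))).
  rewrite /jackson_value B2m_split big_ltn // -/PG /M /rho_factor -/A; ring.
have PA0 : \prod_s th (A * xq N s) != 0 by apply/prodf_neq0 => s _.
have PA1 : \prod_(s | s != v) th (A * xq N s) != 0 by apply/prodf_neq0 => s _.
have UP r : coef_up r * jackson_value a b N (up j r) =
  if r \in I then M * (node_coef r * (th (rho1 * xq j r) * th (rho2 * xq j r)) * (A / (rho1 * rho2 * xq j r))
     * th (A * D) * \prod_(s in I :\ r) th (D / xq j s)
     * (\prod_s th (xq N s / xq j r) / \prod_s th (A * xq N s))) else 0.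
  case: ifPn => rI; last first.
    rewrite /jackson_value /B2m /iA mle_up (_ : (j r < N r)%N = false) ?andbF ?mulr0 ?mul0r ?mulr0 //.
    by move: rI; rewrite inE => /negPf.
  have xf : x_factor (up j r) = x_factor j * (th (rho1 * xq j r) * th (rho2 * xq j r)).
    rewrite /x_factor (bigD1 r) //= [in RHS](bigD1 r) //= upE eqxx addn1 !qpochS.
    have -> : \prod_(i | i != r) (qpoch (rho1 * x i) (up j r i) * qpoch (rho2 * x i) (up j r i)) =
       \prod_(i | i != r) (qpoch (rho1 * x i) (j i) * qpoch (rho2 * x i) (j i)).
      by apply: eq_bigr => s /negPf sr; rewrite upE sr addn0.
    by rewrite /xq !mulrA; ring.
  rewrite /jackson_value xf mabs_up wt_up.
  have -> : B2m a b N (up j r) = th b * p1 * th (A * D) * (VS * \prod_(s in I :\ r) th (D / xq j s))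
   * (iA N j * (up_ratio j r * \prod_s th (xq N s / xq j r))) / dd / \prod_s th (A * xq N s).
    by rewrite -B2m_up_target // mulfK.
  have h' : dd != 0 by apply/prodf_neq0 => s _.
  rewrite -/PG /coef_up /M.
  have u0 := up_ratio_neq0 j r; have X0 := xq_neq0 j r.
  by field; rewrite u0 X0 rho10 rho20 h' PA0.
have DOWN : coef_down * jackson_value (a * q) (b * q) (down N v) j =
  M * (th (b * q ^+ mabs N / (c * Z)) * (th (c * q ^+ mabs N / rho1) * th (c * q ^+ mabs N / rho2))
    * \prod_(s in I :\ v) th (D / xq N s)
    * (\prod_s th (A * xq j s) / \prod_(s | s != v) th (A * xq N s)) / th tau).
  have G : \prod_(mabs j <= i < mabs (down N v)) rho_factor (a * q) i = PG.
    rewrite /PG -(mabs_down Nv) big_add1 /=; apply: eq_bigr => i _.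
    by rewrite /rho_factor [in RHS]exprS [q * _ in RHS]mulrC !mulrA; congr (th (_ / _) * th (_ / _)); ring.
  rewrite /jackson_value G wt_q.
  have -> : B2m (a * q) (b * q) (down N v) j = p1 * (VS * \prod_(s in I :\ v) th (D / xq N s))
   * (iA N j * \prod_s th (Z / xq j s)) * \prod_s th (a * q * x s) / dd / \prod_(s | s != v) th (A * xq N s).
    by rewrite -B2m_down_target mulfK.
  rewrite /coef_down /node_coef0 /rho_factor /M prednK; last by apply: leq_ltn_trans jN'.
  have h' : dd != 0 by apply/prodf_neq0 => s _.
  have h1 : \prod_s th (Z / xq j s) != 0 by apply/prodf_neq0 => s _.
  have h2 : \prod_s th (a * q * x s) != 0.
    by apply/prodf_neq0 => s _; have := nza s 0; rewrite expr1; congr (th _ != 0); ring.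
  have h3 := nztau; have h4 : q ^+ mabs j != 0 by exact: expf_neq0.
  by field; rewrite h' h1 h2 h3 h4 PA1.
rewrite LE DOWN partial_fraction_target mulrDr; congr (_ + _).
rewrite mulr_sumr big_mkcond /=; apply: eq_bigr => r _.
by rewrite UP.
Qed.

End Factors.

(** * The elliptic Jackson summation of type A *)

Section Jackson.
Variables (K : fieldType) (th : K -> K) (q : K) (n : nat) (x : 'I_n -> K).
Hypothesis thL : theta_law th.
Hypothesis q0 : q != 0.
Hypothesis x0 : forall r, x r != 0.
Hypothesis nzx : forall (j k : mindex n) r s, r != s -> th (xq q x j r / xq q x k s) != 0.
Hypothesis nzq : forall m : nat, th (q ^+ m.+1) != 0.
Variables (c rho1 rho2 : K).
Hypothesis c0 : c != 0.
Hypothesis rho10 : rho1 != 0.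
Hypothesis rho20 : rho2 != 0.
Hypothesis nzc0 : forall s, th (c * x s) != 0.
Hypothesis nzc : forall s m, th (c * x s * q ^+ m.+1) != 0.
Implicit Types (j k N : mindex n).

Local Notation jterm := (jackson_term th q x c rho1 rho2).
Local Notation jvalue := (jackson_value th q x rho1 rho2).

Lemma jackson_term_out a b N k j : ~~ (mle j k && mle k N) -> jterm a b N k j = 0.
Proof.
by rewrite negb_and => /orP[] h; rewrite /jackson_term /B1m /B2m {2}/iA /iA (negPf h) !(mulr0, mul0r).
Qed.

Lemma jackson_value_out a b N j : ~~ mle j N -> jvalue a b N j = 0.
Proof. by move=> h; rewrite /jackson_value /B2m /iA (negPf h) !(mulr0, mul0r). Qed.

Lemma iA_diag N : iA th q x N N = 1.
Proof.
rewrite /iA (introT (mleP N N)) // /dA big1 ?invr1 // => r _; rewrite big1 // => s _.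
by rewrite subnn /qpoch big_geq.
Qed.

Lemma jackson_diag a b N : (forall s m, th (a * x s * q ^+ m.+1) != 0) ->
  jterm a b N N N = jvalue a b N N.
Proof.
move=> nza; rewrite /jackson_term /jackson_value /B1m /B2m iA_diag !subnn big_geq // big_geq //.
have qpoch0 z : qpoch th q z 0 = 1 by rewrite /qpoch big_geq.
rewrite qpoch0 !mulr1 mul1r.
rewrite [\prod_r qpoch _ _ _ (N r - N r)]big1 => [|r _]; last by rewrite subnn qpoch0.
rewrite [\prod_r qpoch _ _ _ (N r - N r)]big1 => [|r _]; last by rewrite subnn qpoch0.
have qpoch_neq0 y m : (forall i, th (y * q ^+ i.+1) != 0) -> qpoch th q (y * q) m != 0.
  move=> h; elim: m => [|m IH]; first by rewrite qpoch0 oner_neq0.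
  by rewrite qpochS mulf_neq0 // -mulrA -exprS.
have e : vwp th q x c N * \prod_r qpoch th q (c * x r) (N r + mabs N) = \prod_r qpoch th q (c * x r * q) (N r + mabs N).
  rewrite /vwp -big_split; apply: eq_bigr => r _ /=.
  apply: (mulIf (nzc0 r)); rewrite mulrAC mulfVK // [LHS]mulrC -qpochS qpochSl mulrC //.
have h1 : \prod_r qpoch th q (c * x r * q) (N r + mabs N) != 0.
  by apply/prodf_neq0 => r _; apply: qpoch_neq0.
have h2 : \prod_r qpoch th q (a * x r * q) (N r + mabs N) != 0.
  by apply/prodf_neq0 => r _; apply: qpoch_neq0.
set P1 := \prod_r qpoch th q (c * x r) _ in e *; set P2 := \prod_r qpoch th q (c * x r * q) _ in e h1 *.
set P3 := \prod_r _ in h2 *.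
transitivity (qpoch th q b (mabs N + mabs N) * x_factor th q x rho1 rho2 N * wt q x rho1 rho2 a N / P3 * ((vwp th q x c N * P1) / P2)).
  by field; rewrite h1 h2.
by rewrite e divff // ; field.
Qed.

(** Induction on |N| - |j|: by jackson_term_rec and jackson_value_rec both sides
    satisfy the same recursion, in which j is raised or N is lowered, the latter
    with (a, b) replaced by (a q, b q). This preserves the balancing condition,
    and c, rho1, rho2 do not move. For j = N a single term remains. *)
Theorem elliptic_jackson a b N j (s : seq (mindex n)) :
  a != 0 -> b != 0 -> (forall r m, th (a * x r * q ^+ m.+1) != 0) ->
  b * (rho1 * rho2) = a * c * q -> mle j N ->
  uniq s -> (forall k, mle k N -> k \in s) ->
  \sum_(k <- s) jterm a b N k j = jvalue a b N j.
Proof.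
move=> a0 b0 nza bal jN us.
have [m] := ubnP (mabs N - mabs j); elim: m => // m IH in a b N j a0 b0 nza bal jN *.
move=> Hm Ns; have [->|jneN] := eqVneq j N.
  rewrite (bigD1_seq N) //=; last by apply: Ns; apply/mleP.
  rewrite jackson_diag // big1 ?addr0 // => k kN; apply: jackson_term_out.
  apply: contra kN => /andP[/mleP h1 /mleP h2]; apply/eqP/ffunP => r.
  by apply/eqP; rewrite eqn_leq h1 h2.
have [v jv] : exists v, (j v < N v)%N.
  apply/existsP; apply: contraNT jneN; rewrite negb_exists => /forallP h.
  apply/eqP/ffunP => r; apply/eqP; rewrite eqn_leq; move/mleP: jN => -> /=.
  by have := h r; rewrite -leqNgt.
have Nv : (0 < N v)%N by exact: leq_ltn_trans jv.
have mjN : (mabs j < mabs N)%N.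
  by rewrite ltn_neqAle leq_mabs // andbT; apply: contra jneN => /eqP /(mle_mabs_eq jN) ->.
rewrite (jackson_value_rec thL q0 x0 nzx nzq a0 c0 nza nzc jv b0 rho10 rho20 bal jN).
rewrite (eq_bigr _ (fun k _ => jackson_term_rec thL q0 x0 nzx nzq a0 c0 nza nzc jv b rho1 rho2 k)).
rewrite big_split /=; congr (_ + _).
  rewrite exchange_big /=; apply: eq_bigr => r _; rewrite -mulr_sumr; congr (_ * _).
  have [uN|uN] := boolP (mle (up j r) N); last first.
    rewrite jackson_value_out // big1 // => k _; apply: jackson_term_out.
    by apply: contra uN => /andP[/mleP h1 /mleP h2]; apply/mleP => t; apply: leq_trans (h1 t) (h2 t).
  by apply: IH => //; rewrite mabs_up subnS; move: Hm; rewrite -subn_gt0 in mjN; case: (mabs N - mabs j)%N mjN.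
rewrite -mulr_sumr; congr (_ * _); apply: IH.
- by rewrite mulf_neq0.
- by rewrite mulf_neq0.
- move=> r i; have := nza r i.+1; congr (th _ != 0); rewrite exprS; ring.
- by transitivity (b * (rho1 * rho2) * q); [ring|rewrite bal; ring].
- by rewrite mle_down // jN.
- move: Hm; have := mabs_down Nv; case: (mabs N) mjN => // N' mjN [->] Hm.
  by rewrite subSn // in Hm.
- by move=> k; rewrite mle_down // => /andP[kN _]; exact: Ns.
Qed.

End Jackson.

(** * Translation of the definitions *)

Section Boxes.
Variable n : nat.
Implicit Types (j k N : mindex n).

(** Turns the sums over mbox N into sums over a list, which can be exchanged. *)
Definition box N : seq (mindex n) :=
  [seq k <- [seq [ffun r => nat_of_ord (f r)] | f : {ffun 'I_n -> 'I_(mabs N).+1}] | mle k N].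

Lemma mem_box N k : (k \in box N) = mle k N.
Proof.
rewrite mem_filter; apply: andb_idr => kN; apply/mapP.
exists [ffun r => inord (k r)]; rewrite ?mem_enum //; apply/ffunP => r.
rewrite !ffunE inordK // ltnS; apply: leq_trans (leq_mabs kN).
by rewrite /mabs (bigD1 r) //= leq_addr.
Qed.

Lemma box_uniq N : uniq (box N).
Proof.
rewrite filter_uniq // map_inj_uniq ?enum_uniq // => f g /ffunP fg.
by apply/ffunP => r; apply: val_inj; have := fg r; rewrite !ffunE.
Qed.

Lemma sum_mbox (K : zmodType) N (F : mindex n -> K) :
  (\sum_(k \in mbox N) F k)%classic = \sum_(k <- box N) F k.
Proof.
have -> : mbox N = [set` box N]%classic.
  by apply/seteqP; split=> k /=; rewrite mem_box => /mleP.
by rewrite -fsbig_seq ?box_uniq.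
Qed.

Lemma sum_sub_box (K : zmodType) N k (F : mindex n -> K) : mle k N ->
  \sum_(j <- box k) F j = \sum_(j <- box N | mle j k) F j.
Proof.
move=> kN; rewrite -[RHS]big_filter; apply: perm_big; apply: uniq_perm.
- exact: box_uniq.
- exact/filter_uniq/box_uniq.
move=> j; rewrite mem_box [RHS]mem_filter mem_box andb_idr // => /mleP jk.
by apply/mleP => r; apply: leq_trans (jk r) _; move/mleP: kN.
Qed.

End Boxes.

Section Bridge.
Variables (K : numFieldType) (q p : K) (n : nat) (x : 'I_n -> K).
Hypothesis q0 : q != 0.
Hypothesis x0 : forall r, x r != 0.
Implicit Types (j k N : mindex n) (a b c : K).
Local Notation th := (fun z : K => theta z p).

Lemma qpfact_qpoch z (m l : nat) : (l <= m)%N ->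
  qpfact q p z (m%:Z - l%:Z) = qpoch th q z (m - l).
Proof. by move=> lm; rewrite (subzn lm). Qed.

Lemma xq_shift_ratio j r s :
  q ^ (1 + (j r)%:Z - (j s)%:Z) * x r / x s = q * xq q x j r / xq q x j s.
Proof.
rewrite /xq !(expfzDr _ _ q0) expr1z -exprnN -exprnP; field.
by rewrite x0 expf_neq0.
Qed.

Lemma denA_dA k j : mle j k -> denA q p x k j = dA th q x k j.
Proof.
move=> /mleP jk; apply: eq_bigr => r _; apply: eq_bigr => s _.
by rewrite qpfact_qpoch // xq_shift_ratio.
Qed.

Lemma iA_denA k j : mle j k -> iA th q x k j = (denA q p x k j)^-1.
Proof. by move=> jk; rewrite /iA jk denA_dA. Qed.

Lemma B1_B1m a b k j : mle j k -> B1 q p x k j a b = B1m th q x a b k j.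
Proof.
move=> jk; rewrite /B1 /B1m iA_denA // qpfact_qpoch ?leq_mabs //.
by rewrite !mulrA.
Qed.

Lemma B2_B2m a b N j : a != 0 -> mle j N -> B2 q p x N j a b = B2m th q x a b N j.
Proof.
move=> a0 jN; rewrite /B2 /B2m iA_denA // invfM !mulrA; congr (_ * _ * _ / _).
apply: eq_bigr => r _; have rN : (j r <= N r)%N by exact/mleP.
rewrite qpfact_qpoch //; congr (qpoch _ _ _ _).
rewrite /xq (expfzDr _ _ q0) -exprnN -exprnP; field.
by rewrite a0 x0 expf_neq0.
Qed.

End Bridge.

(** * The Bailey transform *)

Lemma theta_theta_law (R : realType) (K : numFieldType) (p : K) :
  complex_over R K -> `|p| < 1 -> theta_law (fun z : K => theta z p).
Proof.
move=> X p1; split.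
- exact: (theta1 X).
- exact: (thetaV X).
- exact: (theta_three_term X).
- exact: (theta_div0 X).
Qed.

Section Transform.
Variables (K : numFieldType) (n : nat) (q p : K) (x : 'I_n -> K) (rho1 rho2 : K).
Hypothesis thL : theta_law (fun z : K => theta z p).
Hypothesis n0 : (0 < n)%N.
Hypothesis q0 : q != 0.
Hypothesis x0 : forall r, x r != 0.
Hypothesis rho10 : rho1 != 0.
Hypothesis rho20 : rho2 != 0.
Implicit Types (j k N : mindex n) (a b c : K).
Local Notation th := (fun z : K => theta z p).

Lemma qpfact_last z m : qpfact q p z (m.+1)%N != 0 -> theta (z * q ^+ m) p != 0.
Proof.
by rewrite -[qpfact _ _ _ _]/(qpoch th q z m.+1) qpochS mulf_eq0 negb_or => /andP[].
Qed.

Lemma denA_factor k j r s : mle j k -> denA q p x k j != 0 ->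
  qpoch th q (q * xq q x j r / xq q x j s) (k r - j r) != 0.
Proof.
by move=> jk; rewrite denA_dA // /dA => /prodf_neq0 /(_ r isT) /prodf_neq0 /(_ s isT).
Qed.

(** The non-vanishing of dA k j for all j <= k contains that of every theta factor
    it is built from: raise j in the single direction r by m + 1 steps. *)
Lemma generic_theta_ratio a b j r s m : B_generic q p x a b ->
  theta (q * xq q x j r / xq q x j s * q ^+ m) p != 0.
Proof.
case=> _ _ gen; pose k : mindex n := [ffun t => (j t + (if t == r then m.+1 else 0))%N].
have jk t : (j t <= k t)%N by rewrite ffunE leq_addr.
have [dA0 _] := gen k j jk.
have := denA_factor r s (introT (mleP j k) jk) dA0.
by rewrite ffunE eqxx addKn qpochS mulf_eq0 negb_or => /andP[].
Qed.

Lemma generic_theta_q a b m : B_generic q p x a b -> theta (q ^+ m.+1) p != 0.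
Proof.
move=> gen; have := generic_theta_ratio [ffun=> 0%N] (Ordinal n0) (Ordinal n0) m gen.
by rewrite mulfK ?xq_neq0 // -exprS.
Qed.

(** Take an index equal to j r at r and to (k s) + 1 at s; the additional
    power of q cancels the one in front of the ratio. *)
Lemma generic_theta_x a b j k r s : B_generic q p x a b -> r != s ->
  theta (xq q x j r / xq q x k s) p != 0.
Proof.
move=> gen rs.
pose i : mindex n := [ffun t => if t == r then j r else (k s).+1].
have := generic_theta_ratio i r s 0 gen.
rewrite /xq !ffunE eqxx [s == r]eq_sym (negPf rs) expr0 exprS.
congr (theta _ p != 0); field.
by rewrite q0 x0 expf_neq0.
Qed.

Lemma generic_theta_a a b r m : B_generic q p x a b -> theta (a * x r * q ^+ m.+1) p != 0.
Proof.
case=> _ _ gen; pose k : mindex n := [ffun=> m.+1].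
have [_] := gen k [ffun=> 0%N] (fun t => ltac:(by rewrite !ffunE)).
rewrite /denB => /prodf_neq0 /(_ r isT).
have -> : (k r + mabs ([ffun=> 0%N] : mindex n))%N = m.+1.
  by rewrite /mabs big1 ?addn0 ?ffunE // => s _; rewrite ffunE.
by move/qpfact_last; rewrite exprS mulrA.
Qed.

Variables (a b : K).
Hypothesis genB : B_generic q p x a b.
Hypothesis genR : rho_generic q p x rho1 rho2 a b.
Local Notation c := (shiftb q rho1 rho2 a b).

Let a0 : a != 0. Proof. by case: genB. Qed.
Let b0 : b != 0. Proof. by case: genB. Qed.

Lemma shiftb_neq0 : c != 0.
Proof. by rewrite /shiftb !mulf_neq0 ?invr_eq0 ?mulf_neq0. Qed.

(** The balancing condition of the Jackson sum: it is the reason for the shift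
    of b. *)
Lemma shiftb_balance : b * (rho1 * rho2) = a * c * q.
Proof. by rewrite /shiftb; field; rewrite a0 q0. Qed.

Lemma B_generic_shiftb : B_generic q p x a c.
Proof. by case: genB => _ _ gen; split=> //; exact: shiftb_neq0. Qed.

Let shiftb_x r u : b * rho1 * rho2 * x r * u / (a * q) = c * x r * u.
Proof. by rewrite /shiftb; ring. Qed.

Lemma generic_theta_shiftb0 r : theta (c * x r) p != 0.
Proof.
case: genR => _ _ /(_ r) + _.
by rewrite (_ : b * rho1 * rho2 * x r / (a * q) = c * x r) // /shiftb; ring.
Qed.

Lemma generic_theta_shiftb r m : theta (c * x r * q ^+ m.+1) p != 0.
Proof.
case: genR => _ _ _ gen; pose N : mindex n := [ffun=> m.+1].
have := gen N [ffun=> 0%N] (fun t => ltac:(by rewrite !ffunE)) r.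
have -> : (mabs ([ffun=> 0%N] : mindex n) + N r)%N = m.+1.
  by rewrite /mabs big1 ?add0n ?ffunE // => s _; rewrite ffunE.
move/qpfact_last; congr (theta _ p != 0); rewrite /shiftb exprS; field.
by rewrite a0 q0.
Qed.

Local Notation rhof := (rho_factor th q rho1 rho2).

Lemma num_rho_prod m : num_rho q p rho1 rho2 a b m = \prod_(0 <= i < m) rhof c i.
Proof.
rewrite /num_rho mulrC -big_split; apply: eq_bigr => i _; rewrite /rho_factor /=.
congr (theta _ p * theta _ p); rewrite /shiftb exprS; field; by rewrite a0 q0 ?rho10 ?rho20.
Qed.

Lemma den_rho_prod m : den_rho q p rho1 rho2 a m = \prod_(0 <= i < m) rhof a i.
Proof.
rewrite /den_rho -big_split; apply: eq_bigr => i _; rewrite /rho_factor /=.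
by congr (theta _ p * theta _ p); rewrite exprS; ring.
Qed.

(** The coefficient of beta k in the sum that defines the new beta. *)
Definition transform_term N k : K :=
  num_x q p x rho1 rho2 k / num_rho q p rho1 rho2 a b (mabs k)
      * (qpfact q p b (mabs N + mabs k)%N / denA q p x N k)
      * (\prod_(r < n)
           (theta (b * rho1 * rho2 * x r * q ^+ (k r + mabs k) / (a * q)) p
            / theta (b * rho1 * rho2 * x r / (a * q)) p))
      * (\prod_(r < n)
           (qpfact q p
              (a * q ^ (1 + (mabs N)%:Z - (N r)%:Z) / (rho1 * rho2 * x r))
              ((N r)%:Z - (k r)%:Z)
            / qpfact q p (b * rho1 * rho2 * x r / a) (mabs k + N r)%N))
      * weight q x rho1 rho2 a k.

(** The arguments match because b rho1 / a = c q / rho2 and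
    b rho2 / a = c q / rho1. *)
Lemma transform_term_jackson N k j : mle j k -> mle k N ->
  num_rho q p rho1 rho2 a b (mabs N) * (transform_term N k * B1 q p x k j a c)
  = jackson_term th q x c rho1 rho2 a b N k j.
Proof.
move=> jk kN; rewrite /transform_term /jackson_term B1_B1m //.
have num0 : num_rho q p rho1 rho2 a b (mabs k) != 0 by case: genR.
have -> : num_rho q p rho1 rho2 a b (mabs N)
    = num_rho q p rho1 rho2 a b (mabs k) * \prod_(mabs k <= i < mabs N) rhof c i.
  by rewrite !num_rho_prod -big_cat_nat ?leq_mabs.
have -> : \prod_(r < n) (theta (b * rho1 * rho2 * x r * q ^+ (k r + mabs k) / (a * q)) p
            / theta (b * rho1 * rho2 * x r / (a * q)) p) = vwp th q x c k.
  apply: eq_bigr => r _; rewrite shiftb_x; congr (_ / theta _ p).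
  by rewrite /shiftb; ring.
have -> : (\prod_(r < n)
           (qpfact q p
              (a * q ^ (1 + (mabs N)%:Z - (N r)%:Z) / (rho1 * rho2 * x r))
              ((N r)%:Z - (k r)%:Z)
            / qpfact q p (b * rho1 * rho2 * x r / a) (mabs k + N r)%N)) =
   (\prod_r qpoch th q (b * q ^+ mabs N / (c * xq q x N r)) (N r - k r))
   / \prod_r qpoch th q (c * x r * q) (N r + mabs k).
  rewrite big_split /= prodfV; congr (_ * _^-1); apply: eq_bigr => r _.
    rewrite qpfact_qpoch; last exact/mleP.
    congr (qpoch _ _ _ _); rewrite /xq /shiftb !(expfzDr _ _ q0) expr1z -exprnN -exprnP; field.
    by rewrite a0 b0 q0 x0 rho10 rho20 expf_neq0.
  rewrite addnC -[LHS]/(qpoch th q _ _); congr (qpoch _ _ _ _).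
  by rewrite /shiftb; field; rewrite a0 q0.
rewrite /B2m iA_denA // -[num_x _ _ _ _ _ _]/(x_factor th q x rho1 rho2 k).
rewrite -[weight _ _ _ _ _ _]/(wt q x rho1 rho2 a k) -[qpfact _ _ _ _]/(qpoch th q b (mabs N + mabs k)).
set d := denA _ _ _ _ _; set P := \prod_r qpoch th q (c * x r * q) _.
set X := x_factor _ _ _ _ _ _; set W := wt _ _ _ _ _ _; set B := B1m _ _ _ _ _ _ _.
set V := vwp _ _ _ _ _; set Y := \prod_r qpoch _ _ _ _; set nr := num_rho _ _ _ _ _ _ _ in num0 *.
set rr := \prod_(_ <= i < _) _.
transitivity ((nr / nr) * (qpoch th q b (mabs N + mabs k) * Y / d / P * (X * rr) * V * W * B)).
  by ring.
by rewrite divff // mul1r.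
Qed.

Lemma jackson_value_B2 N j : mle j N ->
  jackson_value th q x rho1 rho2 a b N j / den_rho q p rho1 rho2 a (mabs N)
  = B2 q p x N j a b
    * (num_x q p x rho1 rho2 j / den_rho q p rho1 rho2 a (mabs j) * weight q x rho1 rho2 a j).
Proof.
move=> jN; rewrite /jackson_value B2_B2m //.
have den0 m : den_rho q p rho1 rho2 a m != 0 by case: genR.
have e : den_rho q p rho1 rho2 a (mabs N)
    = den_rho q p rho1 rho2 a (mabs j) * \prod_(mabs j <= i < mabs N) rhof a i.
  by rewrite !den_rho_prod -big_cat_nat ?leq_mabs.
have rr0 : \prod_(mabs j <= i < mabs N) rhof a i != 0.
  by have := den0 (mabs N); rewrite e mulf_eq0 => /norP[].
rewrite e -[num_x _ _ _ _ _ _]/(x_factor th q x rho1 rho2 j) -[weight _ _ _ _ _ _]/(wt q x rho1 rho2 a j).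
move: (den0 (mabs j)) rr0; set d := den_rho _ _ _ _ _ _; set rr := \prod_(_ <= i < _) _ => d0 rr0.
by field; rewrite d0 rr0.
Qed.

(** The Jackson summation, as an identity between the coefficients of alpha j in
    the expansions of the two sides of the transform. *)
Lemma transform_jackson_sum N j : mle j N ->
  num_rho q p rho1 rho2 a b (mabs N) / den_rho q p rho1 rho2 a (mabs N)
   * \sum_(k <- box N | mle j k) transform_term N k * B1 q p x k j a c
  = B2 q p x N j a b
    * (num_x q p x rho1 rho2 j / den_rho q p rho1 rho2 a (mabs j) * weight q x rho1 rho2 a j).
Proof.
move=> jN; rewrite -jackson_value_B2 // mulrAC; congr (_ / _).
rewrite -(@elliptic_jackson _ th q n x thL q0 x0 _ _ c rho1 rho2 _ rho10 rho20 _ _ a b N j (box N)) //.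
- rewrite mulr_sumr [LHS]big_mkcond /=; apply: eq_big_seq => k.
  rewrite mem_box => kN; case: ifP => jk; first exact: transform_term_jackson.
  by rewrite jackson_term_out // jk.
- by move=> i k r s rs; exact: generic_theta_x genB rs.
- by move=> m; exact: generic_theta_q genB.
- exact: shiftb_neq0.
- exact: generic_theta_shiftb0.
- exact: generic_theta_shiftb.
- by move=> r m; exact: generic_theta_a genB.
- exact: shiftb_balance.
- exact: box_uniq.
- by move=> k; rewrite mem_box.
Qed.

End Transform.

(** Insert the pair at (a, shiftb a b) into beta', exchange the sums, and compare
    the coefficients of each alpha j by transform_jackson_sum. *)
Lemma WP_Bailey_transform (K : numFieldType) (n : nat) (q p : K) (x : 'I_n -> K)
    (rho1 rho2 : K) (G : K -> K -> Prop) (alpha beta : mindex n -> K -> K -> K) :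
  theta_law (fun z : K => theta z p) ->
  (0 < n)%N -> q != 0 -> (forall r, x r != 0) -> rho1 != 0 -> rho2 != 0 ->
  WP_Bailey_pair (fun a b => G a b /\ B_generic q p x a b) (B1 q p x) alpha beta ->
  WP_Bailey_pair
    (fun a b => [/\ G a (shiftb q rho1 rho2 a b), B_generic q p x a b
                  & rho_generic q p x rho1 rho2 a b])
    (B2 q p x) (alpha' q p x rho1 rho2 alpha) (beta' q p x rho1 rho2 beta).
Proof.
move=> thL n0 q0 x0 rho10 rho20 pairB1 a b [Gac genB genR] N.
have betaE k : mle k N -> beta k a (shiftb q rho1 rho2 a b) =
    \sum_(j <- box N | mle j k) B1 q p x k j a (shiftb q rho1 rho2 a b) * alpha j a (shiftb q rho1 rho2 a b).
  move=> kN; rewrite -sum_sub_box // -sum_mbox; apply: pairB1; split=> //.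
  exact: B_generic_shiftb genB.
rewrite /beta' !sum_mbox.
under eq_big_seq => k kN.
  rewrite mem_box in kN; rewrite -/(transform_term _ _ _ _ _ _ _ _ _) betaE // mulr_sumr big_mkcond /=.
  over.
rewrite exchange_big /= mulr_sumr; apply: eq_big_seq => j; rewrite mem_box => jN.
have := transform_jackson_sum thL n0 q0 x0 rho10 rho20 genB genR jN.
rewrite /alpha' => /(congr1 ( *%R^~ (alpha j a (shiftb q rho1 rho2 a b)))) /= e.
rewrite [RHS]mulrA -{}e -[RHS]mulrA mulr_suml -big_mkcond /=; congr (_ * _).
by apply: eq_bigr => k _; rewrite mulrA.
Qed.

Unset Implicit Arguments.

Theorem theorem4p10 (R : realType) (n : nat) (q p : R[i]) (x : 'I_n -> R[i])
    (rho1 rho2 : R[i]) (G : R[i] -> R[i] -> Prop)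
    (alpha beta : mindex n -> R[i] -> R[i] -> R[i]) :
  (0 < n)%N ->
  q != 0 -> `|p| < 1 ->
  (forall r, x r != 0) -> rho1 != 0 -> rho2 != 0 ->
  WP_Bailey_pair (fun a b => G a b /\ B_generic q p x a b)
    (B1 q p x) alpha beta ->
  WP_Bailey_pair
    (fun a b => [/\ G a (shiftb q rho1 rho2 a b), B_generic q p x a b
                  & rho_generic q p x rho1 rho2 a b])
    (B2 q p x) (alpha' q p x rho1 rho2 alpha) (beta' q p x rho1 rho2 beta).
Proof.
move=> n0 q0 p1; apply: WP_Bailey_transform n0 q0.
exact: theta_theta_law (complex_over_complex R) p1.
Qed.
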